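(* Let $b\ge2$ be an integer and let $(\xi(w))_{w\in\mathscr{A}^+}$ be independent random variables with common distribution $\mathcal{N}(0,1)$. Then, almost surely, for all $w\in\mathscr{A}^*$ the limit in $$M([w])=b^{-|w|}\sqrt{b-1}\left(\lim_{n\to\infty}\sum_{v\in\bigcup_{k=1}^n\mathscr{A}^k}b^{-|v|}\xi(wv)+\sum_{1\le k\le|w|}\xi(w|_k)\right)$$ exists, and $M$ is a finitely additive Gaussian random measure on the cylinders of $\mathscr{A}^\omega$, i.e. the family $(M([w]))_{w\in\mathscr{A}^*}$ is Gaussian and, almost surely, $M([w])=\sum_{\ell\in\mathscr{A}}M([w\ell])$ for all $w\in\mathscr{A}^*$. Moreover, the primitive of the projection of $M$ on $[0,1]$, that is, the continuous process $(X_t)_{t\in[0,1]}$ with $X_0=0$ and, almost surely, $\Delta(X,I_w)=M([w])$ for all $w\in\mathscr{A}^*$, exists and is a centered Gaussian process such that for all $j\ge1$ the covariance matrix $M_j$ of $\bigl(\Delta(X,I_w)\bigr)_{w\in\mathscr{A}^j}$ is $$M_j(w,w')=\begin{cases}b^{-2j}\bigl(1+(b-1)|w|\bigr)&\text{if }w=w',\\ b^{-2j}(b-1)\,|w\wedge w'|&\text{otherwise.}\end{cases}$$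
   Context: $\mathscr{A}=\{0,\dots,b-1\}$, $\mathscr{A}^*=\bigcup_{n\ge0}\mathscr{A}^n$ is the set of finite words (including the empty word), $\mathscr{A}^+$ the set of non-empty finite words, and $\mathscr{A}^\omega$ the set of infinite words. For $w\in\mathscr{A}^*$, $|w|$ is its length, $w|_k$ its prefix of length $k\le|w|$, $wv$ is concatenation, and $[w]\subset\mathscr{A}^\omega$ is the cylinder of infinite words having $w$ as a prefix. For $w,w'\in\mathscr{A}^n$, $w\wedge w'$ is their longest common prefix. For $w=w_1\cdots w_n$, $I_w=\left[\sum_{k=1}^n w_kb^{-k},\ \sum_{k=1}^n w_kb^{-k}+b^{-n}\right]$. For a function $f$ on $[0,1]$ and $I=[\alpha,\beta]$, $\Delta(f,I)=f(\beta)-f(\alpha)$. *)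

(* Defs.v *)
From HB Require Import structures.
From mathcomp Require Import all_boot all_order all_algebra.
From mathcomp Require Import all_classical all_reals all_analysis.

Set Implicit Arguments.
Unset Strict Implicit.
Unset Printing Implicit Defensive.

Import Order.TTheory GRing.Theory Num.Theory.
Import numFieldNormedType.Exports.

Local Open Scope classical_set_scope.
Local Open Scope ring_scope.

Section Words.
Context {b : nat} {R : realType}.

Notation word := (seq 'I_b).

Fixpoint lcp (w w' : word) : word :=
  match w, w' with
  | x :: s, y :: s' => if x == y then x :: lcp s s' else [::]
  | _, _ => [::]
  end.

(* I_w is the interval [word_left w, word_right w]; the k-th letter, counted
   from 0, has weight b ^ -(k + 1). *)
Definition word_left (w : word) : R :=
  \sum_(k < size w) (tnth (in_tuple w) k)%:R * b%:R ^- k.+1.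

Definition word_right (w : word) : R := word_left w + b%:R ^- size w.

Definition Delta (f : R -> R) (w : word) : R :=
  f (word_right w) - f (word_left w).

End Words.

Section Probability.
Context {d : measure_display} {T : measurableType d} {R : realType}.
Variable P : probability T R.

(* Only measurable sets are tested: [distribution P X = mu] would also compare
   the two set functions on non-measurable sets, where they carry no meaning. *)
Definition has_law (X : T -> R) (mu : set R -> \bar R) : Prop :=
  measurable_fun setT X /\
  forall A : set R, measurable A -> P (X @^-1` A) = mu A.

Definition mutually_independent (I : choiceType) (D : set I)
    (X : I -> T -> R) : Prop :=
  forall J : seq I, uniq J -> (forall i, i \in J -> D i) ->
  forall A : I -> set R, (forall i, measurable (A i)) ->
  (P (\bigcap_(i in [set` J]) (X i @^-1` A i)) =
   \prod_(i <- J) P (X i @^-1` A i))%E.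

(* Degenerate laws are Gaussian. They need a separate clause because
   [normal_prob m 0] is the uniform law on [0, 1], not the Dirac mass at m. *)
Definition gaussian_rv (X : T -> R) : Prop :=
  (exists m : R, has_law X (\d_m : set R -> \bar R)) \/
  (exists m s : R, 0 < s /\ has_law X (normal_prob m s)).

Definition gaussian_family (I : Type) (D : set I) (X : I -> T -> R) : Prop :=
  forall (n : nat) (i : 'I_n -> I) (a : 'I_n -> R), (forall k, D (i k)) ->
  gaussian_rv (fun omega => \sum_(k < n) a k * X (i k) omega).

Definition centered_gaussian_process (X : R -> T -> R) : Prop :=
  gaussian_family `[0, 1] X /\
  forall t : R, t \in `[0, 1] -> ('E_P[X t] = 0)%E.

End Probability.

Section Cascade.
Context {b : nat} {d : measure_display} {T : measurableType d} {R : realType}.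
Variable P : probability T R.

Notation word := (seq 'I_b).

Section Measure.
(* Only the values of xi at non-empty words matter below. *)
Variable xi : word -> T -> R.

Definition tail_sum (w : word) (omega : T) (n : nat) : R :=
  \sum_(1 <= k < n.+1) \sum_(v : k.-tuple 'I_b)
    b%:R ^- k * xi (w ++ v) omega.

(* Random mass of the cylinder [w]; at the points omega where the limit does
   not exist, [limn] is an arbitrary fixed real number. *)
Definition cylinder_mass (w : word) (omega : T) : R :=
  b%:R ^- size w * Num.sqrt (b%:R - 1) *
  (limn (tail_sum w omega) +
   \sum_(1 <= k < (size w).+1) xi (take k w) omega).

End Measure.

(* X is a continuous process on [0, 1] vanishing at 0 whose increments over the
   b-adic intervals are given by M; values of X t for t outside [0, 1] are
   irrelevant. *)
Definition is_primitive (M : word -> T -> R) (X : R -> T -> R) : Prop :=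
  [/\ forall t : R, t \in `[0, 1] -> measurable_fun setT (X t),
      forall omega, {within `[0, 1], continuous (fun t => X t omega)},
      forall omega, X 0 omega = 0 &
      {ae P, forall omega, forall w : word,
         Delta (fun t => X t omega) w = M w omega}].

End Cascade.

(* Main.v *)
Require Import Defs.
From HB Require Import structures.
From mathcomp Require Import all_boot all_order all_algebra.
From mathcomp Require Import all_classical all_reals all_analysis.
From mathcomp Require Import measurable_realfun.
From mathcomp Require Import zify ring lra.

(* Every random variable of interest is an almost sure limit of linear
   combinations of the xi(w).  A finite combination of independent standard
   normals is s * Z with Z standard normal (completing the square), and almost
   sure limits preserve this form: the deviations s_n have a finite cluster
   point s, and the expectations of bounded continuous functions identify the
   limit law with that of s * Z.  Covariances then follow by polarization from
   the variances of the truncated sums.  For the sample paths,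
   E(sum over |w| = j of M([w])^2) decays geometrically, so almost surely
   |M([w])| <= C r^|w| with r < 1, and X_t is the limit of the sums of M over
   the b-adic intervals of level j lying to the left of t. *)

Set Implicit Arguments.
Unset Strict Implicit.
Unset Printing Implicit Defensive.

Import Order.TTheory GRing.Theory Num.Theory.
Import numFieldNormedType.Exports.

Local Open Scope classical_set_scope.
Local Open Scope ring_scope.

(** * Gaussian integrals and convolution *)

(** Gaussianity of the masses and of [X] at real times concerns arbitrary linear combinations, whose
    variances have no convenient formula. They need not be known: the deviations of the
    approximations stay bounded merely because the limit is finite-valued. Variances are computed
    only for pairs of words of equal length, where the limiting deviation is explicit. Independence
    is given as a product formula for finitely many events, so a sum is built one variable at a time
    while an event on the remaining variables is carried along. Decay of the masses comes from
    counting: level [j] has [b ^ j] words, each with variance of order [j * b ^- (2 * j)].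
    Integrating the sum of squares over a whole level controls all its words at once, and no
    Gaussian tail estimate enters. *)

Section LebesgueAffine.
Context {R : realType}.
Local Notation mu := (@lebesgue_measure R).
Local Open Scope ereal_scope.

Lemma measurable_affine (a c : R) :
  measurable_fun setT (fun x : R => a * x + c)%R.
Proof. by apply: measurable_funD => //; exact: measurable_funM. Qed.

(** The scaled pushforward gives each interval []u, v]] its length, and this characterizes Lebesgue
    measure. *)
Lemma lebesgue_measure_affine (a c : R) (A : set R) : (0 < a)%R ->
  measurable A -> mu A = a%:E * mu ((fun x => a * x + c)%R @^-1` A).
Proof.
move=> a0 mA.
have mf := measurable_affine a c.
pose phi := (fun x => a * x + c)%R : measurableTypeR R -> measurableTypeR R.
have mphi : measurable_fun setT phi by [].
pose m' : {measure set (measurableTypeR R) -> \bar R} := pushforward mu phi.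
have := @lebesgue_measure_unique R (mscale (NngNum (ltW a0)) (m' mphi)).
rewrite /= /mscale/= /pushforward/=.
apply => // _ [[u v]] _ <-.
have -> : phi @^-1` `]u, v] = `]((u - c) / a)%R, ((v - c) / a)%R]%classic.
  apply/seteqP; split => x /=; rewrite !in_itv/= ltr_pdivrMr// ler_pdivlMr//;
  by rewrite /phi ltrBlDr lerBrDr mulrC.
rewrite !lebesgue_measure_itv/= !lte_fin ltr_pM2r ?invr_gt0// ltrD2r.
case: ifPn => _; last by rewrite mule0.
rewrite -!EFinD -EFinM; congr EFin; field; exact: lt0r_neq0.
Qed.

Lemma ge0_integral_affine (a c : R) (f : R -> \bar R) : (0 < a)%R ->
  measurable_fun setT f -> (forall x, 0 <= f x) ->
  \int[mu]_x f x = a%:E * \int[mu]_x f (a * x + c)%R.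
Proof.
move=> a0 mf f0.
have mphi := measurable_affine a c.
pose phi := (fun x => a * x + c)%R : measurableTypeR R -> measurableTypeR R.
rewrite (_ : \int[mu]_x f (a * x + c)%R = \int[pushforward mu phi]_x f x); last first.
  by rewrite ge0_integral_pushforward.
rewrite -(ge0_integral_mscale _ _ (NngNum (ltW a0)))//.
apply: eq_measure_integral => A mA _.
exact: lebesgue_measure_affine.
Qed.

Lemma ge0_integral_opp (f : R -> \bar R) :
  measurable_fun setT f -> (forall x, 0 <= f x) ->
  \int[mu]_x f x = \int[mu]_x f (- x)%R.
Proof.
move=> mf f0.
pose phi := -%R : measurableTypeR R -> measurableTypeR R.
have mphi : measurable_fun setT phi by exact: oppr_measurable.
rewrite (_ : \int[mu]_x f (- x)%R = \int[pushforward mu phi]_x f x); last first.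
  by rewrite ge0_integral_pushforward.
apply: eq_measure_integral => A mA _.
exact/esym/lebesgue_measureN.
Qed.

End LebesgueAffine.

(** * Integration against a density *)

Section Density.
Local Open Scope ereal_scope.
Context d (T : measurableType d) (R : realType).
Variables (mu nu : {measure set T -> \bar R}) (g : T -> R).
Hypotheses (mg : measurable_fun setT g) (g0 : forall x, (0 <= g x)%R).
Hypothesis nuE : forall A, measurable A -> nu A = \int[mu]_(x in A) (g x)%:E.

Import HBNNSimple.

(** The density is assumed on sets only; the identity passes to simple functions by summing over
    their values, then to [f] by monotone convergence. *)
Lemma ge0_integral_density (f : T -> \bar R) :
  measurable_fun setT f -> (forall x, 0 <= f x) ->
  \int[nu]_x f x = \int[mu]_x (f x * (g x)%:E).
Proof.
move=> mf f0.
pose f_ := nnsfun_approx measurableT mf.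
have f_f x : (f_ n x)%:E @[n --> \oo] --> f x.
  by apply: cvg_nnsfun_approx => //.
have f_nd x m n : (m <= n)%N -> (f_ m x)%:E <= (f_ n x)%:E.
  by move=> mn; rewrite lee_fin; exact/lefP/nd_nnsfun_approx.
transitivity (limn (fun n => \int[nu]_x (f_ n x)%:E)).
  rewrite -monotone_convergence//.
  - by apply: eq_integral => x _; apply/esym/cvg_lim.
  - by move=> n; exact/measurable_EFinP/measurable_funTS.
  - by move=> *; rewrite lee_fin.
  - by move=> x _ m n; exact: f_nd.
transitivity (limn (fun n => \int[mu]_x ((f_ n x)%:E * (g x)%:E))).
  apply/congr_lim/funext => n.
  transitivity (\sum_(r \in range (f_ n)) \int[nu]_x (r * \1_(f_ n @^-1` [set r]) x)%:E).
    rewrite -ge0_integral_fsum//.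
    - by apply: eq_integral => x _; rewrite fsumEFin// -fimfunE.
    - by move=> r; exact/measurable_EFinP/measurable_funM.
    - by move=> r x _; rewrite nnfun_muleindic_ge0.
  transitivity (\sum_(r \in range (f_ n)) \int[mu]_x ((r * \1_(f_ n @^-1` [set r]) x)%:E * (g x)%:E)).
    apply: eq_fsbigr => r _.
    under [RHS]eq_integral => x _ do rewrite EFinM -muleA.
    (* A negative [r] is not a value of the nonnegative simple function, so both integrals vanish;
       for [r >= 0] the constant can be pulled out. *)
    have [r0|r0] := leP 0%R r; last first.
      rewrite !integral0_eq// => x _; rewrite preimage_nnfun0// indic0 ?mulr0//.
      by rewrite mul0e mule0.
    have mi : measurable_fun setT (fun x => (\1_(f_ n @^-1` [set r]) x : R)%:E).
      by apply/measurable_EFinP; exact: measurable_indic.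
    have mgE : measurable_fun setT (fun x => (g x)%:E) by exact/measurable_EFinP.
    rewrite [RHS]ge0_integralZl//; last 2 first.
      exact: emeasurable_funM.
      by move=> x _; rewrite mule_ge0// lee_fin.
    under eq_integral do rewrite EFinM.
    rewrite ge0_integralZl//.
    congr (_ * _); rewrite integral_indic// setIT nuE// [LHS]integral_mkcond.
    by apply: eq_integral => x _; rewrite epatch_indic muleC.
  rewrite -ge0_integral_fsum//.
  - apply: eq_integral => x _; rewrite -ge0_mule_fsuml.
      by rewrite fsumEFin// -fimfunE.
    by move=> r; rewrite nnfun_muleindic_ge0.
  - move=> r; apply: emeasurable_funM; last exact/measurable_EFinP.
    by apply/measurable_EFinP/measurable_funM => //; exact: measurable_indic.
  - move=> r x _; apply: mule_ge0; last by rewrite lee_fin.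
    by rewrite EFinM nnfun_muleindic_ge0.
rewrite -monotone_convergence//.
- apply: eq_integral => x _; apply/cvg_lim => //.
  by apply: cvgeZr.
- move=> n; apply: emeasurable_funM; first exact/measurable_EFinP/measurable_funTS.
  exact/measurable_EFinP.
- by move=> n x _; rewrite mule_ge0// lee_fin.
- by move=> x _ m n mn; rewrite lee_pmul ?lee_fin//; exact: f_nd.
Qed.
End Density.

Section GaussianLaw.
Context {R : realType}.
Implicit Types (f : R -> \bar R) (s t m : R).
Local Notation mu := (@lebesgue_measure R).
Local Notation N01 := (normal_prob (0 : R) 1).
Local Open Scope ereal_scope.

Lemma normal_probT m s : normal_prob m s setT = 1.
Proof. exact: integral_normal_pdf. Qed.

Lemma ge0_integral_normal_prob m s f :
  measurable_fun setT f -> (forall x, 0 <= f x) ->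
  \int[normal_prob m s]_x f x = \int[mu]_x (f x * (normal_pdf m s x)%:E).
Proof.
move=> mf f0; apply: ge0_integral_density => //.
- exact: measurable_normal_pdf.
- exact: normal_pdf_ge0.
Qed.

Lemma normal_pdf_affine c t x : (0 < t)%R ->
  (normal_pdf c t (t * x + c) = t^-1 * normal_pdf 0 1 x)%R.
Proof.
move=> t0; have tn0 := lt0r_neq0 t0.
rewrite !normal_pdfE ?oner_eq0// mulrA; congr (_ * _)%R.
  rewrite /normal_peak expr1n mul1r -mulrnAr sqrtrM ?sqr_ge0// invfM.
  by rewrite sqrtr_sqr gtr0_norm.
by rewrite /normal_fun addrK subr0 expr1n; congr expR; field.
Qed.

(** The right side keeps a density against Lebesgue measure: the centre [c] will depend on another
    variable, and Tonelli is then applied to a fixed measure. *)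
Lemma ge0_integral_normal_affine c t f : (0 < t)%R ->
  measurable_fun setT f -> (forall x, 0 <= f x) ->
  \int[N01]_y f (t * y + c)%R = \int[mu]_z (f z * (normal_pdf c t z)%:E).
Proof.
move=> t0 mf f0; have ma := measurable_affine t c.
have mp : measurable_fun setT (fun z => (normal_pdf c t z)%:E).
  by apply/measurable_EFinP; exact: measurable_normal_pdf.
have mfa : measurable_fun setT (fun y => f (t * y + c)%R).
  exact: (measurableT_comp mf ma).
rewrite (ge0_integral_normal_prob _ _ mfa (fun y => f0 _)).
rewrite [RHS](ge0_integral_affine c t0); last 2 first.
- exact: emeasurable_funM.
- by move=> x; rewrite mule_ge0// lee_fin normal_pdf_ge0.
rewrite -ge0_integralZl//; last 3 first.
- by apply: emeasurable_funM; [exact: mfa|exact: (measurableT_comp mp ma)].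
- by move=> x _; rewrite mule_ge0// lee_fin normal_pdf_ge0.
- by rewrite lee_fin ltW.
apply: eq_integral => x _.
by rewrite normal_pdf_affine// muleCA -EFinM mulVKf// gt_eqF.
Qed.

Lemma normal_prob_sym f :
  measurable_fun setT f -> (forall x, 0 <= f x) ->
  \int[N01]_x f (- x)%R = \int[N01]_x f x.
Proof.
move=> mf f0.
have mo : measurable_fun setT (fun x : R => - x)%R by exact: oppr_measurable.
have mp : measurable_fun setT (fun z : R => (normal_pdf 0 1 z)%:E).
  by apply/measurable_EFinP; exact: measurable_normal_pdf.
rewrite !ge0_integral_normal_prob//; last exact: measurableT_comp mf mo.
rewrite [RHS]ge0_integral_opp; last 2 first.
- exact: emeasurable_funM.
- by move=> x; rewrite mule_ge0// lee_fin normal_pdf_ge0.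
apply: eq_integral => x _; congr (_ * _%:E).
by rewrite !normal_pdfE ?oner_eq0// /normal_fun !subr0 sqrrN.
Qed.

(* Completing the square in x. *)
Lemma normal_pdf_mul s t x z : (0 < t)%R ->
  let r := Num.sqrt (s ^+ 2 + t ^+ 2) in
  (normal_pdf 0 1 x * normal_pdf (s * x) t z =
   normal_pdf 0 r z * normal_pdf (s * z / r ^+ 2) (t / r) x)%R.
Proof.
move=> t0 r; have tn0 := lt0r_neq0 t0.
have q0 : (0 < s ^+ 2 + t ^+ 2)%R by rewrite ltr_wpDl ?sqr_ge0// exprn_gt0.
have r0 : (0 < r)%R by rewrite sqrtr_gt0.
have rn0 := lt0r_neq0 r0.
have rr : (r ^+ 2 = s ^+ 2 + t ^+ 2)%R by rewrite sqr_sqrtr// ltW.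
move: r r0 rn0 rr => r r0 rn0 rr.
rewrite !normal_pdfE ?oner_eq0 ?mulf_neq0 ?invr_eq0//.
rewrite mulrACA [RHS]mulrACA; congr (_ * _)%R.
  rewrite /normal_peak -!invfM -!sqrtrM; last 2 first.
  - by rewrite mulrn_wge0// mulr_ge0 ?sqr_ge0 ?pi_ge0.
  - by rewrite mulrn_wge0// mulr_ge0 ?sqr_ge0 ?pi_ge0.
  by congr (Num.sqrt _)^-1%R; field.
rewrite /normal_fun -!expRD; congr expR.
(* Multiplying the exponents by [2 r^2 t^2] leaves polynomials that agree once [r ^+ 2] is replaced
   by [s ^+ 2 + t ^+ 2]. *)
apply: (mulfI (_ : (r ^+ 2 * t ^+ 2 *+ 2 != 0)%R)).
  by rewrite mulrn_eq0/= mulf_eq0 !expf_eq0/= negb_or rn0.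
transitivity (- (r ^+ 2 * t ^+ 2 * x ^+ 2) - r ^+ 2 * (z - s * x) ^+ 2)%R.
  by field.
transitivity (- (t ^+ 2 * z ^+ 2) - (r ^+ 2 * x - s * z) ^+ 2)%R; last first.
  by field; rewrite rn0 tn0.
by rewrite rr; ring.
Qed.

(** For [t > 0] the inner integral has density [normal_pdf (s * x) t] in the value [z] of the sum.
    After Tonelli, the completed square leaves [normal_pdf 0 r z] times a density in [x] of total
    mass 1. No sign is imposed, since [t] will be an arbitrary coefficient. *)
Lemma integral_normal_add s t f :
  measurable_fun setT f -> (forall x, 0 <= f x) ->
  \int[N01]_x \int[N01]_y f (s * x + t * y)%R =
  \int[N01]_z f (Num.sqrt (s ^+ 2 + t ^+ 2) * z)%R.
Proof.
move=> mf f0.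
(* The inner law is symmetric and the right side depends on [t ^+ 2] only. *)
wlog t0 : t / (0 <= t)%R.
  move=> H; have [/H//|t0] := leP 0%R t.
  rewrite -[in RHS](sqrrN t) -H; last by rewrite oppr_ge0 ltW.
  apply: eq_integral => x _.
  rewrite -(@normal_prob_sym (fun y => f (s * x + t * y)%R))//.
    by under eq_integral do rewrite mulrN -mulNr.
  by apply: (measurableT_comp mf); exact: measurable_funD.
(* For [t = 0] there is no density in [z]: the inner integrand is constant, and [Num.sqrt (s ^+ 2)],
   the absolute value of [s], is matched with [s] by symmetry. *)
move: t0; rewrite le_eqVlt => /predU1P[<-|t0].
  under eq_integral do under eq_integral do rewrite mul0r addr0.
  rewrite expr0n/= addr0 sqrtr_sqr.
  under eq_integral do rewrite integral_cst//= normal_probT mule1.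
  have [s0|s0] := leP 0%R s.
    by apply: eq_integral => x _; rewrite ger0_norm.
  rewrite -(@normal_prob_sym (fun x => f (s * x)%R))//.
    by apply: eq_integral => x _; rewrite ltr0_norm// mulrN mulNr.
  by apply: (measurableT_comp mf) => //; exact: measurable_funM.
set r := Num.sqrt _.
have r0 : (0 < r)%R by rewrite sqrtr_gt0 ltr_wpDl ?sqr_ge0// exprn_gt0.
have mp c u : measurable_fun setT (fun z : R => (normal_pdf c u z)%:E).
  by apply/measurable_EFinP; exact: measurable_normal_pdf.
have mp2 : measurable_fun setT (fun xz : R * R => (normal_pdf (s * xz.1) t xz.2)%:E).
  apply/measurable_EFinP; rewrite /normal_pdf gt_eqF//.
  apply: measurable_funM => //; apply: measurableT_comp => //.
  apply: measurable_funM => //; apply: measurableT_comp => //.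
  apply: measurable_funX; apply: measurable_funB => //.
  exact: measurable_funM.
transitivity (\int[mu]_x \int[mu]_z
    (f z * ((normal_pdf (s * x) t z)%:E * (normal_pdf 0 1 x)%:E))).
  rewrite ge0_integral_normal_prob; last 2 first.
  - apply: (@measurable_fun_fubini_tonelli_F _ _ _ _ _ N01
      (fun xy => f (s * xy.1 + t * xy.2)%R)) => //.
    apply: (measurableT_comp mf); apply: measurable_funD; exact: measurable_funM.
  - by move=> x; apply: integral_ge0.
  apply: eq_integral => x _.
  under [X in X * _]eq_integral do rewrite addrC.
  rewrite (ge0_integral_normal_affine (s * x) t0)//.
  rewrite -ge0_integralZr//; last 3 first.
  - exact: (emeasurable_funM mf (mp _ _)).
  - by move=> z _; rewrite mule_ge0// lee_fin normal_pdf_ge0.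
  - by rewrite lee_fin normal_pdf_ge0.
  by apply: eq_integral => z _; rewrite muleA.
rewrite (@fubini_tonelli _ _ _ _ _ mu mu (fun xz : R * R =>
    f xz.2 * ((normal_pdf (s * xz.1) t xz.2)%:E * (normal_pdf 0 1 xz.1)%:E)))//; last 2 first.
- apply: emeasurable_funM; first exact: measurableT_comp mf measurable_snd.
  apply: emeasurable_funM => //; exact: measurableT_comp (mp 0%R 1%R) measurable_fst.
- by move=> xz; rewrite !mule_ge0// lee_fin normal_pdf_ge0.
transitivity (\int[mu]_z (f z * (normal_pdf 0 r z)%:E)).
  apply: eq_integral => z _.
  under eq_integral => x _.
    rewrite /= -EFinM [X in X%:E]mulrC normal_pdf_mul// EFinM muleA.
    over.
  rewrite ge0_integralZl//; last 3 first.
  - exact: mp.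
  - by move=> x _; rewrite lee_fin normal_pdf_ge0.
  - by rewrite mule_ge0// lee_fin normal_pdf_ge0.
  by rewrite integral_normal_pdf mule1.
rewrite -(ge0_integral_normal_affine 0 r0)//.
by apply: eq_integral => z _; rewrite addr0.
Qed.

End GaussianLaw.

(** * Second moment of the standard normal law *)

Section SecondMoment.
Context {R : realType}.
Local Notation mu := (@lebesgue_measure R).
Local Notation N01 := (normal_prob (0 : R) 1).
Local Notation phi := (normal_pdf (0 : R) 1).
Local Open Scope ereal_scope.

Let phiE x : (phi x = normal_peak 1 * expR (- x ^+ 2 / 2))%R.
Proof. by rewrite normal_pdfE ?oner_eq0// /normal_fun subr0 expr1n. Qed.

Let derive_phi (x : R) : is_derive x 1%R (fun x => - phi x)%R (x * phi x)%R.
Proof.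
rewrite (_ : (fun x => - phi x)%R = (fun x => - normal_peak 1 * expR (- x ^+ 2 / 2))%R); last first.
  by apply/funext => y; rewrite phiE -mulNr.
rewrite phiE; apply: is_derive_eq.
by rewrite /GRing.scale/= !mulr0 add0r; field.
Qed.

Let cvg_phi : (- phi x)%R @[x --> +oo%R] --> (0 : R)%R.
Proof.
rewrite (_ : (fun x => - phi x)%R = (fun x => - normal_peak 1 * expR (- x ^+ 2 / 2))%R); last first.
  by apply/funext => y; rewrite phiE -mulNr.
rewrite -[X in _ --> X](mulr0 (- normal_peak 1)%R); apply: cvgMl_tmp.
apply: (@squeeze_cvgr _ _ _ _ (cst 0%R) (fun x => expR (- (x / 2)))%R).
- near=> x; have x1 : (1 <= x)%R by near: x; exact: nbhs_pinfty_ge.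
  rewrite expR_ge0/= ler_expR mulNr lerN2 ler_pM2r ?invr_gt0//.
  by rewrite expr2 ler_peMl// (le_trans ler01).
- exact: cvg_cst.
- apply: (cvg_comp (fun x : R => x / 2)%R (fun y => expR (- y))); last exact: cvgr_expR.
  by apply: gt0_cvgMly => //; rewrite invr_gt0.
Unshelve. all: end_near. Qed.

(** [- phi] is a primitive of [u * phi u] and vanishes at infinity. *)
Let tail_phi (x : R) : (0 <= x)%R ->
  \int[mu]_(u in `[x, +oo[) (u * phi u)%:E = (phi x)%:E.
Proof.
move=> x0.
rewrite (@ge0_continuous_FTC2y _ _ (fun x => - phi x)%R x 0%R)//.
- by rewrite sub0e -EFinN opprK.
- by move=> u xu; rewrite mulr_ge0 ?normal_pdf_ge0// (le_trans x0).
- apply: continuous_subspaceT => u.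
  by apply: cvgM; [exact: cvg_id|apply: continuous_normal_pdf; exact: oner_neq0].
- by move=> u _; have := derive_phi u => -[].
- apply: cvgN; apply: cvg_at_right_filter.
  by apply: continuous_normal_pdf; exact: oner_neq0.
- by move=> u _; rewrite derive1E; exact: derive_val.
Qed.

(** Tonelli replaces integration by parts: when [phi x], written as the tail integral of
    [u * phi u], is integrated over [x >= 0], each [u] receives the weight [u]. Hence [phi] and
    [u ^+ 2 * phi u] have the same integral over the half-line. *)
Lemma integral_normal_sqr : \int[N01]_x (x ^+ 2)%:E = 1.
Proof.
have mphi : measurable_fun setT (fun x => phi x) := measurable_normal_pdf 0 1.
have cphi : continuous phi by apply: continuous_normal_pdf; exact: oner_neq0.
have phi0 := normal_pdf_ge0 (0 : R) 1.
have phiN (x : R) : phi (- x)%R = phi x by rewrite !phiE sqrrN.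
rewrite ge0_integral_normal_prob; last 2 first.
- by apply/measurable_EFinP; exact: measurable_funX.
- by move=> x; rewrite lee_fin sqr_ge0.
under eq_integral do rewrite -EFinM.
rewrite ge0_symfun_integralT; last 3 first.
- by move=> x; rewrite mulr_ge0 ?sqr_ge0.
- by move=> x; apply: cvgM; [exact: exprn_continuous|exact: cphi].
- by move=> x /=; rewrite sqrrN phiN.
have := integral_normal_pdf (0 : R) 1.
rewrite ge0_symfun_integralT// => [<-|x /=]; last by rewrite phiN.
congr (_ * _); symmetry.
have m0 : measurable [set x : R | 0 <= x]%R by rewrite -set_itvcy.
pose h (xu : R * R) : \bar R :=
  ((if (0 <= xu.1) && (xu.1 <= xu.2) then xu.2 * phi xu.2 else 0)%R)%:E.
have mh : measurable_fun setT h.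
  apply/measurable_EFinP; apply: measurable_fun_ifT => //.
    apply: measurable_and; apply: measurable_fun_ler => //.
  by apply: measurable_funM => //; exact: (measurableT_comp mphi).
have h0 xu : 0 <= h xu.
  rewrite lee_fin; case: ifPn => // /andP[x0 xu0].
  by rewrite mulr_ge0// (le_trans x0).
transitivity (\int[mu]_x \int[mu]_u h (x, u)).
  rewrite integral_mkcond; apply: eq_integral => x _.
  rewrite patchE /h; case: ifPn => [|/negP]; rewrite inE/= => x0; last first.
    move/negP/negbTE in x0.
    by rewrite integral0_eq// => u _ /=; rewrite x0.
  rewrite -tail_phi// integral_mkcond; apply: eq_integral => u _.
  by rewrite patchE/= x0/= mem_setE in_itv/= andbT; case: ifP.
rewrite (fubini_tonelli (m1 := mu) (m2 := mu))// [RHS]integral_mkcond.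
apply: eq_integral => u _.
rewrite patchE /h; case: ifPn => [|/negP]; rewrite inE/= => u0; last first.
  rewrite integral0_eq// => x _ /=; case: ifPn => // /andP[x0 xu].
  by exfalso; apply: u0; exact: le_trans xu.
transitivity (\int[mu]_(x in `[0%R, u]) (u * phi u)%:E).
  rewrite [RHS]integral_mkcond; apply: eq_integral => x _.
  by rewrite patchE mem_setE in_itv/=; case: ifP.
rewrite integral_cst//= lebesgue_measure_itv/= lte_fin.
move: u0; rewrite le_eqVlt => /predU1P[<-|u0].
  by rewrite ltxx mul0r mul0e expr0n/= mul0r.
by rewrite u0 -EFinD -EFinM subr0 mulrC expr2 mulrA.
Qed.

End SecondMoment.

(* The law of s * Z for a standard normal Z; unlike [normal_prob 0 s], it is
   the Dirac mass at 0 for s = 0. *)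
Definition centered_normal {R : realType} (s : R) (A : set R) : \bar R :=
  normal_prob 0 1 ((fun x => s * x) @^-1` A).

Section CenteredNormal.
Context {d} {T : measurableType d} {R : realType} (P : probability T R).
Implicit Types (X Y : T -> R) (s : R).
Local Notation N01 := (normal_prob (0 : R) 1).
Local Open Scope ereal_scope.

Let mulM s : measurable_fun setT (fun x : R => s * x)%R.
Proof. exact: measurable_funM. Qed.

Lemma ge0_integral_centered_normal X s (f : R -> \bar R) :
  has_law P X (centered_normal s) ->
  measurable_fun setT f -> (forall x, 0 <= f x) ->
  \int[P]_w f (X w) = \int[N01]_x f (s * x)%R.
Proof.
move=> [mX XE] mf f0.
transitivity (\int[pushforward P X]_x f x).
  by rewrite (ge0_integral_pushforward mX).
pose ms := (fun x => s * x)%R : measurableTypeR R -> R.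
have mM : measurable_fun setT ms by exact: mulM.
transitivity (\int[pushforward N01 ms]_x f x); last first.
  by rewrite (ge0_integral_pushforward mM).
by apply: eq_measure_integral => A mA _; rewrite /= /pushforward (XE A mA).
Qed.

Lemma centered_normal_sqr X s : has_law P X (centered_normal s) ->
  \int[P]_w (X w ^+ 2)%:E = (s ^+ 2)%:E.
Proof.
move=> Xs; rewrite (ge0_integral_centered_normal (f := fun x => (x ^+ 2)%:E) Xs); last 2 first.
- by apply/measurable_EFinP; exact: measurable_funX.
- by move=> x; rewrite lee_fin sqr_ge0.
under eq_integral do rewrite exprMn EFinM.
rewrite ge0_integralZl_EFin//; last 3 first.
- by move=> x _; rewrite lee_fin sqr_ge0.
- by apply/measurable_EFinP; exact: measurable_funX.
- exact: sqr_ge0.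
by rewrite integral_normal_sqr mule1.
Qed.

Lemma centered_normal_integrable_sqr X s : has_law P X (centered_normal s) ->
  P.-integrable setT (fun w => (X w ^+ 2)%:E).
Proof.
move=> Xs; have [mX _] := Xs.
apply/integrableP; split; first by apply/measurable_EFinP; exact: measurable_funX.
under eq_integral do rewrite gee0_abs ?lee_fin ?sqr_ge0//.
by rewrite (centered_normal_sqr Xs) ltry.
Qed.

Lemma integrable_mul_of_sqr X Y :
  measurable_fun setT X -> measurable_fun setT Y ->
  P.-integrable setT (fun w => (X w ^+ 2)%:E) ->
  P.-integrable setT (fun w => (Y w ^+ 2)%:E) ->
  P.-integrable setT (fun w => (X w * Y w)%:E).
Proof.
move=> mX mY iX iY.
apply: (@le_integrable _ _ _ _ _ _ _ (fun w => (X w ^+ 2)%:E + (Y w ^+ 2)%:E)) => //.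
- by apply/measurable_EFinP; exact: measurable_funM.
- move=> w _; rewrite /= lee_fin [leRHS]ger0_norm ?addr_ge0 ?sqr_ge0//.
  by rewrite ler_norml; apply/andP; split; nra.
- exact: integrableD.
Qed.

Lemma centered_normal_integrable X s : has_law P X (centered_normal s) ->
  P.-integrable setT (EFin \o X).
Proof.
move=> Xs; have [mX _] := Xs.
have i1 : P.-integrable setT (fun w => (cst 1%R w ^+ 2)%:E).
  apply: (@eq_integrable _ _ _ _ _ _ (cst 1%:E)) => //.
    by move=> w _; rewrite /= expr1n.
  exact: finite_measure_integrable_cst.
have := integrable_mul_of_sqr mX (@measurable_cst _ _ T R setT 1%R)
  (centered_normal_integrable_sqr Xs) i1.
by apply: eq_integrable => // w _; rewrite /= mulr1.
Qed.

(** By symmetry of the normal law the positive and negative parts of [X] have equal integrals;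
    integrability makes them finite, so their difference is 0. *)
Lemma centered_normal_expectation X s : has_law P X (centered_normal s) ->
  'E_P[X] = 0.
Proof.
move=> Xs; have [mX _] := Xs.
have iX := centered_normal_integrable Xs.
have mp : measurable_fun setT (fun x : R => (Num.max x 0)%:E).
  by apply/measurable_EFinP; apply: measurable_maxr.
have mn : measurable_fun setT (fun x : R => (Num.max (- x)%R 0)%:E).
  by apply/measurable_EFinP; apply: measurable_maxr.
rewrite unlock integralE.
have -> : \int[P]_w ((fun w => (X w)%:E)^\+ w) = \int[N01]_x (Num.max (s * x) 0)%:E.
  rewrite -(ge0_integral_centered_normal (f := fun x => (Num.max x 0)%:E) Xs)//.
    by apply: eq_integral => w _; rewrite funeposE -EFin_max.
  by move=> x; rewrite lee_fin le_max lexx orbT.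
have En : \int[P]_w ((fun w => (X w)%:E)^\- w) = \int[N01]_x (Num.max (s * x) 0)%:E.
  transitivity (\int[N01]_x (Num.max (- (s * x))%R 0)%:E).
    rewrite -(ge0_integral_centered_normal (f := fun x => (Num.max (- x)%R 0)%:E) Xs)//.
      by apply: eq_integral => w _; rewrite funenegE -EFinN -EFin_max.
    by move=> x; rewrite lee_fin le_max lexx orbT.
  rewrite -(@normal_prob_sym _ (fun x => (Num.max (s * x) 0)%:E))//.
  - by apply: eq_integral => x _; rewrite mulrN.
  - exact: (measurableT_comp mp (mulM s)).
  - by move=> x; rewrite lee_fin le_max lexx orbT.
rewrite -En subee//; apply: integrable_neg_fin_num => //.
Qed.

(** The product is half of [(X + Y) ^+ 2 - X ^+ 2 - Y ^+ 2], so three one-dimensional laws suffice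
    and no joint law is needed. *)
Lemma covariance_centered_normal X Y s t u :
  has_law P X (centered_normal s) -> has_law P Y (centered_normal t) ->
  has_law P (fun w => X w + Y w)%R (centered_normal u) ->
  covariance P X Y = ((u ^+ 2 - s ^+ 2 - t ^+ 2) / 2)%:E.
Proof.
move=> Xs Yt XYu; have [mX _] := Xs; have [mY _] := Yt.
have iX := centered_normal_integrable Xs.
have iY := centered_normal_integrable Yt.
have iX2 := centered_normal_integrable_sqr Xs.
have iY2 := centered_normal_integrable_sqr Yt.
have iXY2 := centered_normal_integrable_sqr XYu.
rewrite covarianceE; last 3 first.
- exact/Lfun1_integrable.
- exact/Lfun1_integrable.
- by apply/Lfun1_integrable; exact: integrable_mul_of_sqr.
rewrite !(centered_normal_expectation Xs) mul0e sube0 unlock.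
transitivity (\int[P]_w ((2^-1)%:E * ((((X w + Y w) ^+ 2)%:E - (X w ^+ 2)%:E) - (Y w ^+ 2)%:E))).
  apply: eq_integral => w _; rewrite -!EFinB -EFinM; congr EFin.
  by rewrite fctE; field.
rewrite integralZl//; last by apply: integrableB => //; exact: integrableB.
rewrite integralB//; last exact: integrableB.
rewrite integralB//.
by rewrite !(centered_normal_sqr Xs, centered_normal_sqr Yt, centered_normal_sqr XYu)
  -!EFinB -EFinM mulrC.
Qed.

(** For [s = 0] the preimages defining the law are empty or full, which is the Dirac clause;
    otherwise the deviation is the absolute value of [s], the sign being absorbed by symmetry. *)
Lemma gaussian_rv_centered_normal X s :
  has_law P X (centered_normal s) -> gaussian_rv P X.
Proof.
move=> [mX XE]; have [s0|s0] := eqVneq s 0%R.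
  left; exists 0%R; split => // A mA; rewrite XE// /centered_normal s0 diracE.
  case: (boolP (0%R \in A)) => [|/negP]; rewrite inE => A0.
    rewrite (_ : _ @^-1` _ = setT) ?normal_probT//.
    by apply/seteqP; split => x //= _; rewrite mul0r.
  rewrite (_ : _ @^-1` _ = set0) ?measure0//.
  by apply/seteqP; split => x //=; rewrite mul0r.
right; exists 0%R, `|s|%R; split; first by rewrite normr_gt0.
split => // A mA.
have mi : measurable_fun setT (fun x : R => (\1_A x)%:E : \bar R).
  by apply/measurable_EFinP; exact: measurable_indic.
have i0 (x : R) : 0 <= (\1_A x)%:E :> \bar R by rewrite lee_fin.
have XsE : P (X @^-1` A) = \int[N01]_x (\1_A (s * x)%R)%:E.
  rewrite -(ge0_integral_centered_normal (f := fun x => (\1_A x)%:E) (conj mX XE))//.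
  have mXA : measurable (X @^-1` A) by rewrite -[X in measurable X]setTI; exact: mX.
  by rewrite -[RHS]/(\int[P]_w (\1_(X @^-1` A) w)%:E) integral_indic// setIT.
have -> : P (X @^-1` A) = \int[N01]_x (\1_A (`|s| * x + 0)%R)%:E.
  rewrite XsE; under [RHS]eq_integral do rewrite addr0.
  have [_|_] := ger0P s; first by [].
  rewrite -(@normal_prob_sym _ (fun x => (\1_A (s * x)%R)%:E))//.
    by apply: eq_integral => x _; rewrite /= mulrN mulNr.
  exact: (measurableT_comp mi (mulM s)).
rewrite (ge0_integral_normal_affine 0 (f := fun x => (\1_A x)%:E))// ?normr_gt0//.
rewrite /normal_prob [RHS]integral_mkcond; apply: eq_integral => x _.
by rewrite epatch_indic muleC.
Qed.

End CenteredNormal.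

(** * Linear combinations of independent normals *)

(** Finiteness of [m1] is a hypothesis and not a structure because the intended [m1], the law of a
    variable under [P] restricted to an event, is seen to be finite through its formula. The
    instances required by uniqueness of product measures are built inside the proof. *)
Lemma finite_product_measure_unique d1 d2 (T1 : measurableType d1)
    (T2 : measurableType d2) (R : realType) (m1 : {measure set T1 -> \bar R})
    (m2 : {sigma_finite_measure set T2 -> \bar R})
    (m : {measure set (T1 * T2) -> \bar R}) : fin_num_fun m1 ->
  (forall A B, measurable A -> measurable B -> m (A `*` B) = (m1 A * m2 B)%E) ->
  forall C, measurable C -> m C = (\int[m1]_x m2 (xsection C x))%E.
Proof.
move=> m1_fin mE C mC.
have m1_sig : sigma_finite setT m1.
  by apply: fin_num_fun_sigma_finite => //; rewrite measure0.
pose H1 := isFinite.Build _ _ _ _ m1_fin.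
pose H2 := isSFinite.Build _ _ _ _ (sfinite_measure_sigma_finite m1_sig).
pose H3 := isSigmaFinite.Build _ _ _ _ m1_sig.
pose m1' := HB.pack_for (FiniteMeasure.type T1 R) (Measure.sort m1) H1 H2 H3.
by rewrite -(@product_measure_unique _ _ _ _ _ m1' m2 m).
Qed.

Section IndependentSum.
Context {d} {T : measurableType d} {R : realType} (P : probability T R).
Context {I : choiceType}.
Variables (D : set I) (X : I -> T -> R).
Hypothesis X_indep : mutually_independent P D X.
Hypothesis X_law : forall i, D i -> has_law P (X i) (normal_prob 0 1).
Local Notation N01 := (normal_prob (0 : R) 1).

Let S (c : I -> R) (J : seq I) (w : T) : R := \sum_(i <- J) c i * X i w.
Let sd (c : I -> R) (J : seq I) : R := Num.sqrt (\sum_(i <- J) c i ^+ 2).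
Let E (A : I -> set R) (K : seq I) := \bigcap_(i in [set` K]) (X i @^-1` A i).

Let mX i : D i -> measurable_fun setT (X i).
Proof. by move=> /X_law[]. Qed.

Let mS c J : (forall i, i \in J -> D i) -> measurable_fun setT (S c J).
Proof.
elim: J => [|j J IH] H.
  by rewrite (_ : S c [::] = cst 0)//; apply/funext => w; rewrite /S big_nil.
rewrite (_ : S c (j :: J) = (fun w => c j * X j w) \+ S c J)%R; last first.
  by apply/funext => w; rewrite /S big_cons.
apply: measurable_funD.
  by apply: measurable_funM => //; apply: mX; apply: H; rewrite mem_head.
by apply: IH => i iJ; apply: H; rewrite in_cons iJ orbT.
Qed.

Let mE A K : (forall i, i \in K -> D i) -> (forall i, measurable (A i)) ->
  measurable (E A K).
Proof.
move=> HK mA; apply: fin_bigcap_measurable => [|i iK]; first exact: finite_seq.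
by rewrite -[X in measurable X]setTI; apply: mX => //; exact: HK.
Qed.

(** Under [P] restricted to [F] the pair [(Y, Z)] has a product law of total mass [P F], so the
    probability is an iterated integral that [integral_normal_add] evaluates. Keeping [F] in the
    conclusion allows the lemma to be iterated. *)
Lemma indep_normal_add (Y : T -> R) (F : set T) (Z : T -> R) (s c : R) :
  measurable_fun setT Y -> measurable_fun setT Z -> measurable F ->
  (forall B C, measurable B -> measurable C ->
    P (Y @^-1` B `&` (Z @^-1` C `&` F)) =
    (centered_normal s B * (N01 C * P F))%E) ->
  forall B, measurable B ->
    P ((fun w => c * Z w + Y w) @^-1` B `&` F) =
    (centered_normal (Num.sqrt (c ^+ 2 + s ^+ 2)) B * P F)%E.
Proof.
move=> mY mZ mF H B mB.
have PF_fin : P F \is a fin_num by exact: fin_num_measure.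
pose m1 : {measure set R -> \bar R} := pushforward (mrestr P mF) Y.
have m1E A : measurable A -> m1 mY A = (centered_normal s A * P F)%E.
  move=> mA; have := H A setT mA measurableT.
  by rewrite preimage_setT setTI normal_probT mul1e.
have m1_fin : fin_num_fun (m1 mY).
  move=> A mA; rewrite m1E// fin_numM// /centered_normal.
  by apply: fin_num_measure; rewrite -[X in measurable X]setTI; exact: measurable_funM.
pose YZ (w : T) : R * measurableTypeR R := (Y w, Z w).
have mYZ : measurable_fun setT YZ by exact/measurable_fun_pairP.
pose m : {measure set (R * measurableTypeR R) -> \bar R} :=
  pushforward (mrestr P mF) YZ.
pose DB := [set xy : R * measurableTypeR R | B (c * xy.2 + xy.1)].
have mDB : measurable DB.
  have mf : measurable_fun setT (fun xy : R * measurableTypeR R => c * xy.2 + xy.1).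
    by apply: measurable_funD => //; exact: measurable_funM.
  by rewrite -[X in measurable X]setTI; exact: mf.
have mEr (A : set R) (C : set (measurableTypeR R)) : measurable A -> measurable C ->
    m mYZ (A `*` C) = (m1 mY A * N01 C)%E.
  move=> mA mC; rewrite m1E//.
  rewrite [LHS](_ : _ = P (Y @^-1` A `&` (Z @^-1` C `&` F))).
    by rewrite H// muleAC muleA.
  rewrite /m/= /pushforward /mrestr; congr (P _).
  by apply/seteqP; split => w /= [] => [[? ?] ?|? [? ?]].
have -> : P ((fun w => c * Z w + Y w) @^-1` B `&` F) = m mYZ DB by [].
rewrite (finite_product_measure_unique (m2 := N01) m1_fin mEr mDB).
have mB' : measurable_fun setT (fun x : R => (\1_B x)%:E : \bar R).
  by apply/measurable_EFinP; exact: measurable_indic.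
have B0 (x : R) : (0 <= (\1_B x)%:E :> \bar R)%E by rewrite lee_fin.
have N01B (x : R) : N01 (xsection DB x) = (\int[N01]_y (\1_B (x + c * y))%:E)%E.
  rewrite -[xsection _ _]setIT -integral_indic//; last exact: measurable_xsection.
  apply: eq_integral => y _; rewrite !indicE; congr ((_ : bool)%:R%:E).
  by rewrite mem_xsection; apply/idP/idP; rewrite !inE/= addrC.
pose ms := (fun x => s * x) : measurableTypeR R -> R.
have mM : measurable_fun setT ms by exact: measurable_funM.
have PF0 : 0 <= fine (P F) by rewrite fine_ge0.
pose m2 : {measure set R -> \bar R} := pushforward N01 ms.
pose g (x : R) := (\int[N01]_y (\1_B (x + c * y))%:E : \bar R)%E.
have mg : measurable_fun setT g.
  apply: (@measurable_fun_fubini_tonelli_F _ _ _ _ _ N01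
      (fun xy : R * measurableTypeR R => (\1_B (xy.1 + c * xy.2))%:E)) => //.
  apply: (measurableT_comp mB'); apply: measurable_funD => //; exact: measurable_funM.
have g0 x : (0 <= g x)%E by exact: integral_ge0.
transitivity (\int[m1 mY]_x g x)%E; first by apply: eq_integral => x _; exact: N01B.
transitivity (\int[mscale (NngNum PF0) (m2 mM)]_x g x)%E.
  apply: eq_measure_integral => A mA _; rewrite m1E// muleC.
  by rewrite -[X in (X * _)%E]fineK.
rewrite ge0_integral_mscale//= fineK// muleC; congr (_ * _)%E.
rewrite ge0_integral_pushforward//.
transitivity (\int[N01]_x \int[N01]_y (\1_B (s * x + c * y))%:E)%E => //.
rewrite (integral_normal_add s c (f := fun x => (\1_B x)%:E))// addrC.
rewrite /centered_normal -[_ @^-1` _]setIT -integral_indic//.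
by rewrite -[X in measurable X]setTI; exact: measurable_funM.
Qed.

(** The event [E A K] makes the induction on [J] close: splitting [X j] off the sum produces a
    constraint on [X j], which joins the carried event, and the case of [J] applies to it. *)
Let indep_normal_sum_joint c J K A B : uniq (J ++ K) ->
  (forall i, i \in J ++ K -> D i) -> (forall i, measurable (A i)) ->
  measurable B ->
  P (S c J @^-1` B `&` E A K) = (centered_normal (sd c J) B * P (E A K))%E.
Proof.
elim: J K A B => [|j J IH] K A B; rewrite ?cat0s ?cat_cons.
  move=> _ HK mA mB; rewrite /sd big_nil sqrtr0 /centered_normal.
  have S0 w : S c [::] w = 0 by rewrite /S big_nil.
  case: (boolP (0 \in B)) => [|/negP]; rewrite inE => B0.
    rewrite (_ : _ @^-1` B = setT); last first.
      by apply/seteqP; split => w //= _; rewrite S0.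
    rewrite (_ : _ @^-1` B = setT) ?normal_probT ?mul1e ?setTI//.
    by apply/seteqP; split => x //= _; rewrite mul0r.
  rewrite (_ : _ @^-1` B = set0); last first.
    by apply/seteqP; split => w //=; rewrite S0.
  rewrite (_ : _ @^-1` B = set0) ?set0I ?measure0 ?mul0e//.
  by apply/seteqP; split => x //=; rewrite mul0r.
move=> /= /andP[jJK uJK] HD mA mB.
have jD : D j by apply: HD; rewrite mem_head.
have HJK i : i \in J ++ K -> D i by move=> iJK; apply: HD; rewrite in_cons iJK orbT.
have HJ i : i \in J -> D i by move=> iJ; apply: HJK; rewrite mem_cat iJ.
have HK i : i \in K -> D i by move=> iK; apply: HJK; rewrite mem_cat iK orbT.
have jK : j \notin K by apply: contra jJK => jK; rewrite mem_cat jK orbT.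
rewrite (_ : S c (j :: J) = (fun w => c j * X j w + S c J w)); last first.
  by apply/funext => w; rewrite /S big_cons.
have q0 : 0 <= \sum_(i <- J) c i ^+ 2 by apply: sumr_ge0 => i _; exact: sqr_ge0.
rewrite /sd big_cons -[X in c j ^+ 2 + X](sqr_sqrtr q0).
apply: indep_normal_add => //; [exact: mS|exact: mX|exact: mE|].
move=> B' C mB' mC.
(* The new constraint is stored at index [j]; since [j \notin K], those on [K] are unchanged. *)
pose A' i := if i == j then C else A i.
have mA' i : measurable (A' i) by rewrite /A'; case: ifP.
have A'K i : i \in K -> A' i = A i.
  by move=> iK; rewrite /A'; case: eqP => // ij; rewrite -ij iK in jK.
have EK : X j @^-1` C `&` E A K = E A' (j :: K).
  apply/seteqP; split => w.
    move=> [Xj EA] i /=; rewrite in_cons => /predU1P[->|iK].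
      by rewrite /A' eqxx.
    by rewrite A'K//; exact: EA.
  move=> EA'; split; first by have := EA' j (mem_head _ _); rewrite /A' eqxx.
  by move=> i iK; rewrite -A'K//; apply: EA'; rewrite /= in_cons iK orbT.
have uK : uniq (j :: K) by rewrite /= jK; move: uJK; rewrite cat_uniq => /and3P[].
rewrite EK IH//; last 2 first.
- by rewrite -cat1s uniq_catCA/= jJK.
- move=> i; rewrite mem_cat in_cons orbCA => /predU1P[->//|iJK].
  by apply: HJK; rewrite mem_cat.
congr (_ * _)%E; rewrite /E X_indep//; last first.
  by move=> i; rewrite in_cons => /predU1P[->//|]; exact: HK.
rewrite big_cons {1}/A' eqxx (X_law jD).2//; congr (_ * _)%E.
rewrite X_indep//; last by move: uK => /= /andP[].
by apply: eq_big_seq => i iK; rewrite A'K.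
Qed.

Lemma indep_normal_sum (c : I -> R) (J : seq I) : uniq J ->
  (forall i, i \in J -> D i) ->
  has_law P (fun w => \sum_(i <- J) c i * X i w)
            (centered_normal (Num.sqrt (\sum_(i <- J) c i ^+ 2))).
Proof.
move=> uJ HJ; split; first exact: mS.
move=> B mB; have := @indep_normal_sum_joint c J [::] (fun=> setT) B.
rewrite cats0 => /(_ uJ HJ (fun=> measurableT) mB).
rewrite (_ : E _ _ = setT); last by apply/seteqP; split => // w _ i.
by rewrite setIT probability_setT mule1.
Qed.

End IndependentSum.

(** * Almost sure limits of centered normals *)

Section WeakLimit.
Context {R : realType}.
Local Notation N01 := (normal_prob (0 : R) 1).

(** Test functions for weak convergence. Values in [[0, 1]] keep all integrals nonnegative and
    finite, with [cst 1] as dominating function. *)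
Definition cont01 (f : R -> R) := continuous f /\ forall x, 0 <= f x <= 1.

Let cont01_measurable f : cont01 f -> measurable_fun setT f.
Proof. by move=> [cf _]; exact: continuous_measurable_fun. Qed.

Definition mean d (T : measurableType d) (P : probability T R) (X : T -> R) (f : R -> R) : R :=
  fine (\int[P]_w (f (X w))%:E).

Let meanE d (T : measurableType d) (P : probability T R) (X : T -> R) f :
  measurable_fun setT X -> cont01 f -> (mean P X f)%:E = (\int[P]_w (f (X w))%:E)%E.
Proof.
move=> mX cf; rewrite /mean fineK//.
have mfX : measurable_fun setT (fun w => (f (X w))%:E).
  by apply/measurable_EFinP; exact: (measurableT_comp (cont01_measurable cf) mX).
have f0 w : (0 <= (f (X w))%:E)%E by rewrite lee_fin; have /andP[] := cf.2 (X w).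
rewrite ge0_fin_numE ?integral_ge0//.
apply: (@le_lt_trans _ _ (\int[P]_w (cst 1%E) w)%E).
  apply: ge0_le_integral => //.
  by move=> w _; rewrite lee_fin; have /andP[] := cf.2 (X w).
by rewrite integral_cst//= probability_setT mule1 ltry.
Qed.

Let cvg_mean d (T : measurableType d) (P : probability T R) (X_ : nat -> T -> R) (X : T -> R) f :
  (forall n, measurable_fun setT (X_ n)) -> measurable_fun setT X -> cont01 f ->
  {ae P, forall w, X_ n w @[n --> \oo] --> X w} ->
  mean P (X_ n) f @[n --> \oo] --> mean P X f.
Proof.
move=> mX_ mX cf XX.
apply: fine_cvg; rewrite -/(mean P X f) meanE//.
have mfX (Y : T -> R) : measurable_fun setT Y -> measurable_fun setT (fun w => (f (Y w))%:E).
  by move=> mY; apply/measurable_EFinP; exact: (measurableT_comp (cont01_measurable cf) mY).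
have H1 : {ae P, forall w, setT w -> (f (X_ n w))%:E @[n --> \oo] --> (f (X w))%:E}.
  apply: filterS XX => w Xw _; apply: cvg_EFin; first exact: nearW.
  exact: (cvg_comp _ _ Xw (cf.1 (X w))).
have H2 : P.-integrable setT (cst 1%E) by exact: finite_measure_integrable_cst.
have H3 : {ae P, forall w n, setT w -> (`|(f (X_ n w))%:E| <= cst 1 w)%E}.
  apply/aeW => w n _; have /andP[f0 f1] := cf.2 (X_ n w).
  by rewrite gee0_abs lee_fin.
by have [] := dominated_convergence measurableT (fun n => mfX _ (mX_ n)) (mfX _ mX)
  H1 H2 H3.
Qed.

Definition scal (s : R) : measurableTypeR R -> R := fun x => s * x.

Let mscal s : measurable_fun setT (scal s).
Proof. exact: measurable_funM. Qed.

(** Open rays are stable under intersection and generate the Borel sets, and the indicator of a ray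
    is a pointwise limit of the test functions [f_ n]. *)
Lemma has_law_of_mean d (T : measurableType d) (P : probability T R) (X : T -> R) s :
  measurable_fun setT X ->
  (forall f, cont01 f -> mean P X f = mean N01 (scal s) f) ->
  has_law P X (centered_normal s).
Proof.
move=> mX H; split => // A mA.
pose m1 : {measure set R -> \bar R} := pushforward P X.
pose m2 : {measure set R -> \bar R} := pushforward N01 (scal s).
suff : m1 mX A = m2 (mscal s) A by [].
apply: (@measure_unique _ _ _ (@RGenOInfty.G R) (fun n => `]- n%:R, +oo[%classic)) => //.
- exact: RGenOInfty.measurableE.
- move=> _ _ [x ->] [y ->]; exists (Num.max x y).
  by apply/seteqP; split => z /=; rewrite !in_itv/= !andbT gt_max => /andP.
- by move=> n; exists (- n%:R).
- apply/seteqP; split => // x _; exists (Num.bound `|x|) => //=.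
  rewrite in_itv/= andbT ltrNl (le_lt_trans (ler_norm _))// normrN.
  exact: archi_boundP.
- move=> _ [a ->].
  pose f_ (n : nat) (x : R) := Num.min 1 (n%:R * Num.max 0 (x - a)).
  have cf n : cont01 (f_ n).
    split=> [x|x].
      apply: (@continuous_min _ _ (cst 1) (fun x => n%:R * Num.max 0 (x - a)));
        first exact: cst_continuous.
      apply: (@cvgM _ _ _ _ (cst n%:R) (fun x => Num.max 0 (x - a))); first exact: cvg_cst.
      apply: (@continuous_max _ _ (cst 0) (fun x => x - a)); first exact: cst_continuous.
      by apply: cvgB; [exact: cvg_id|exact: cvg_cst].
    rewrite /f_ ge_min lexx/= andbT le_min ler01/=.
    by rewrite mulr_ge0// le_max lexx.
  have f_cvg x : f_ n x @[n --> \oo] --> (\1_(`]a, +oo[%classic) x : R).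
    rewrite indicE mem_setE in_itv/= andbT /f_.
    have [ax|xa] := ltP a x; last first.
      apply: cvg_near_cst; apply: nearW => n.
      by rewrite max_l ?subr_le0// mulr0 min_r.
    apply: cvg_near_cst; near=> n.
    rewrite max_r ?subr_ge0 ?(ltW ax)// min_l//.
    rewrite -ler_pdivrMr ?subr_gt0//; near: n; exact: nbhs_infty_ger.
  have f_int d' (T' : measurableType d') (Q : probability T' R) (Y : T' -> R) :
      measurable_fun setT Y ->
      (\int[Q]_w (f_ n (Y w))%:E)%E @[n --> \oo] --> Q (Y @^-1` `]a, +oo[).
    move=> mY.
    have mYa : measurable (Y @^-1` `]a, +oo[).
      by rewrite -[X in measurable X]setTI; exact: mY.
    rewrite -[X in _ --> X](_ : \int[Q]_w (\1_(Y @^-1` `]a, +oo[) w)%:E = _)%E; last first.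
      by rewrite integral_indic// setIT.
    apply: (@dominated_cvg _ _ _ Q setT measurableT _ _ (cst 1%E)) => //; last first.
    + move=> n w _; have /andP[f0 f1] := (cf n).2 (Y w).
      by rewrite gee0_abs lee_fin; [exact: f1|exact: f0].
    + exact: finite_measure_integrable_cst.
    + by move=> w _; apply: cvg_EFin; [exact: nearW|exact: f_cvg].
    + move=> n; apply/measurable_EFinP.
      exact: (measurableT_comp (cont01_measurable (cf n)) mY).
  have H1 := f_int _ _ P _ mX.
  have H2 := f_int _ _ N01 _ (mscal s).
  change (P (X @^-1` `]a, +oo[) = N01 (scal s @^-1` `]a, +oo[)).
  rewrite -(cvg_lim _ H2)// -(cvg_lim _ H1)//.
  by apply/congr_lim/funext => n; rewrite -!meanE// H//; exact: cf.
- move=> k; change (P (X @^-1` `](- k%:R)%R, +oo[%classic) < +oo)%E.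
  rewrite (le_lt_trans (probability_le1 _ _)) ?ltry//.
  by rewrite -[X in measurable X]setTI; exact: mX.
Unshelve. all: end_near. Qed.

Lemma mean_law d (T : measurableType d) (P : probability T R) (X : T -> R) s f :
  has_law P X (centered_normal s) -> cont01 f -> mean P X f = mean N01 (scal s) f.
Proof.
move=> Xs cf; rewrite /mean; congr fine.
rewrite (ge0_integral_centered_normal (f := fun x => (f x)%:E) Xs)//.
- by apply/measurable_EFinP; exact: cont01_measurable.
- by move=> x; rewrite lee_fin; have /andP[] := cf.2 x.
Qed.

(** For deviations with a known limit: [s_ n * x] converges to [s * x] for every [x], so dominated
    convergence applies on the side of [N01] as well. *)
Lemma centered_normal_lim d (T : measurableType d) (P : probability T R)
    (X_ : nat -> T -> R) (X : T -> R) (s_ : nat -> R) (s : R) :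
  (forall n, has_law P (X_ n) (centered_normal (s_ n))) ->
  measurable_fun setT X ->
  {ae P, forall w, X_ n w @[n --> \oo] --> X w} ->
  s_ n @[n --> \oo] --> s ->
  has_law P X (centered_normal s).
Proof.
move=> X_s mX XX ss; apply: has_law_of_mean => // f cf.
have mX_ n : measurable_fun setT (X_ n) by have [] := X_s n.
have H1 := cvg_mean mX_ mX cf XX.
have H2 : mean N01 (scal (s_ n)) f @[n --> \oo] --> mean N01 (scal s) f.
  apply: cvg_mean => //.
  by apply/aeW => x; apply: cvgM => //; exact: cvg_cst.
rewrite -(cvg_lim _ H2)// -(cvg_lim _ H1)//.
by congr (limn _); apply/funext => n; exact: mean_law.
Qed.

(** Nothing is assumed about [s_]. Large deviations would push mass to infinity and bring the mean
    of [f0] close to 0, whereas it converges to a positive number because [X] is finite-valued. *)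
Lemma centered_normal_closed d (T : measurableType d) (P : probability T R)
    (X_ : nat -> T -> R) (X : T -> R) (s_ : nat -> R) :
  (forall n, has_law P (X_ n) (centered_normal (s_ n))) ->
  measurable_fun setT X ->
  {ae P, forall w, X_ n w @[n --> \oo] --> X w} ->
  exists s, has_law P X (centered_normal s).
Proof.
move=> X_s mX XX.
have mX_ n : measurable_fun setT (X_ n) by have [] := X_s n.
(* Positive everywhere, vanishing at infinity and decreasing in the absolute value of [x]: these
   properties give [l_gt0], [f0_lim] and [mean_mono]. *)
pose f0 (x : R) := (1 + x ^+ 2)^-1.
have f0_pos x : 0 < 1 + x ^+ 2 :> R by rewrite ltr_pwDl ?sqr_ge0.
have cf0 : cont01 f0.
  split=> [x|x].
    apply: cvgV; first by rewrite gt_eqF.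
    by apply: cvgD; [exact: cvg_cst|exact: exprn_continuous].
  by rewrite invr_ge0 ltW//= invf_le1// lerDl sqr_ge0.
have X_f0 : mean N01 (scal (s_ n)) f0 @[n --> \oo] --> mean P X f0.
  apply: cvg_trans (cvg_mean mX_ mX cf0 XX); apply: near_eq_cvg.
  by apply: nearW => n; exact: mean_law.
have l_gt0 : 0 < mean P X f0.
  have mf0X : measurable_fun setT (fun w => (f0 (X w))%:E).
    by apply/measurable_EFinP; exact: (measurableT_comp (cont01_measurable cf0) mX).
  have f0X w : (0 <= (f0 (X w))%:E)%E by rewrite lee_fin; have /andP[] := cf0.2 (X w).
  rewrite lt_neqAle -lee_fin meanE// integral_ge0// andbT; apply/eqP => l0.
  have /(ae_eq_integral_abs P measurableT mf0X) : (\int[P]_w `|(f0 (X w))%:E| = 0)%E.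
    under eq_integral do rewrite gee0_abs//.
    by rewrite -meanE// -l0.
  move=> /(filterS (Q := fun=> False))[].
    move=> w /(_ I) /= [] /eqP; rewrite invr_eq0 => /eqP h.
    by have := f0_pos (X w); rewrite h ltxx.
  move=> A [mA A0 /(_ _)]; rewrite (_ : (~` _) = setT) => [AT|]; last first.
    by rewrite -subTset => w _ [].
  have := probability_setT P; rewrite (_ : setT = A) ?A0; last first.
    by apply/esym; rewrite -subTset.
  by move=> /eqP; rewrite eq_sym onee_eq0.
(* At [x = 0] the integrand stays equal to 1, so the pointwise limit is the indicator of [[set 0]],
   a set that a law with a density does not charge. *)
have f0_lim : mean N01 (scal n%:R) f0 @[n --> \oo] --> (0 : R).
  have m0 : measurable ([set 0] : set (measurableTypeR R)) by exact: measurable_set1.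
  apply: (fine_cvg (a := 0)).
  rewrite (_ : 0%:E = \int[N01]_x (\1_[set 0] x)%:E)%E; last first.
    rewrite integral_indic// setIT; apply/esym; exact: integral_set1.
  apply: (@dominated_cvg _ _ _ N01 setT measurableT _ _ (cst 1%E)) => //; last first.
  - move=> n w _; have /andP[f00 f01] := cf0.2 (scal n%:R w).
    by rewrite gee0_abs lee_fin; [exact: f01|exact: f00].
  - exact: finite_measure_integrable_cst.
  - move=> x _; apply: cvg_EFin; first exact: nearW.
    rewrite indicE; case: (boolP (x \in [set 0])) => [|/negP]; rewrite inE/= => x0.
      by apply: cvg_near_cst; apply: nearW => n /=; rewrite /f0 /scal x0 mulr0 expr0n addr0 invr1.
    apply/cvgr0Pnorm_le => e e0; near=> n.
    have n1 : 1 <= n%:R :> R by rewrite ler1n; near: n; exists 1%N.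
    have x2 : 0 < x ^+ 2 by rewrite exprn_even_gt0//=; apply/eqP.
    have nx : e^-1 / x ^+ 2 <= n%:R by near: n; exact: nbhs_infty_ger.
    rewrite ger0_norm /f0 ?invr_ge0 ?(ltW (f0_pos _))// -[leRHS]invrK lef_pV2 ?posrE ?invr_gt0//.
    rewrite /scal exprMn -[leLHS]add0r lerD//.
    rewrite ler_pdivrMr// in nx; rewrite (le_trans nx)// ler_wpM2r ?(ltW x2)//.
    by rewrite expr2 ler_peMl// (le_trans _ n1).
  - move=> n; apply/measurable_EFinP.
    exact: (measurableT_comp (cont01_measurable cf0) (mscal _)).
have mean_mono (s t : R) : `|t| <= `|s| -> mean N01 (scal s) f0 <= mean N01 (scal t) f0.
  move=> st; rewrite -lee_fin !meanE//.
  apply: ge0_le_integral => //.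
  - by move=> x _; rewrite lee_fin; have /andP[] := cf0.2 (scal s x).
  - by apply/measurable_EFinP; exact: (measurableT_comp (cont01_measurable cf0) (mscal s)).
  - by apply/measurable_EFinP; exact: (measurableT_comp (cont01_measurable cf0) (mscal t)).
  - move=> x _; rewrite lee_fin /f0 /scal lef_pV2 ?posrE//.
    rewrite lerD2l !exprMn ler_wpM2r ?sqr_ge0//.
    by rewrite -[t ^+ 2]real_normK ?num_real// -[s ^+ 2]real_normK ?num_real// ler_sqr ?nnegrE.
(* A deviation larger than [N] in absolute value would, by monotonicity, put the mean of [f0] below
   half of its limit. *)
have [K s_K] : exists K : R, \forall n \near \oo, s_ n \in `[- K, K].
  have [N f0N] : exists N : nat, mean N01 (scal N%:R) f0 < mean P X f0 / 2.
    have l2 : 0 < mean P X f0 / 2 by rewrite divr_gt0.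
    by have [N _ /(_ N)/= h] := cvgr_lt _ f0_lim _ l2; exists N; apply: h.
  exists N%:R; near=> n.
  have : mean P X f0 / 2 < mean N01 (scal (s_ n)) f0.
    near: n; apply: (cvgr_gt _ X_f0).
    by rewrite ltr_pdivrMr// ltr_pMr// ltr1n.
  move=> h; rewrite in_itv/= -ler_norml leNgt; apply/negP => Ns.
  have := lt_trans f0N h; rewrite ltNge mean_mono// normr_nat ltW//.
have FF : ProperFilter (s_ n @[n --> \oo]) by exact: fmap_proper_filter.
have [s [_]] : `[- K, K]%classic `&` cluster (s_ n @[n --> \oo]) !=set0.
  exact: (@segment_compact _ (- K) K).
(* [G] refines both the neighbourhoods of [s] and the image of the sequence, so the means have two
   limits along [G], which must agree. *)
rewrite cluster_cvgE => -[G GF [Gs sG]].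
exists s; apply: has_law_of_mean => // f cf.
have H1 : mean N01 (scal x) f @[x --> G] --> mean N01 (scal s) f.
  apply: (@cvg_trans _ (mean N01 (scal x) f @[x --> s])).
    by move=> A; exact: Gs.
  apply/(@cvg_nbhsP _ R^o (fun x => mean N01 (scal x) f)) => u us.
  apply: cvg_mean => //.
  by apply/aeW => x; apply: cvgM => //; exact: cvg_cst.
have H2 : mean N01 (scal x) f @[x --> G] --> mean P X f.
  have : mean N01 (scal (s_ n)) f @[n --> \oo] --> mean P X f.
    apply: cvg_trans (cvg_mean mX_ mX cf XX); apply: near_eq_cvg.
    by apply: nearW => n; exact: mean_law.
  by move=> h A /h hA; exact: sG.
by rewrite -(cvg_lim _ H1)// -(cvg_lim _ H2).
Unshelve. all: end_near. Qed.

End WeakLimit.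

(** * b-adic words and the primitive of an additive set function *)

Section GeometricSequence.
Context {R : realType}.
Variables (u : nat -> R) (A r : R).
Hypotheses (r0 : 0 <= r) (r1 : r < 1).
Hypothesis uA : forall n, `|u n.+1 - u n| <= A * r ^+ n.

Let A0 : 0 <= A.
Proof. by have := uA 0; rewrite expr0 mulr1; exact: le_trans. Qed.

Let ud n p : `|u (n + p)%N - u n| <= A / (1 - r) * r ^+ n.
Proof.
have r10 : 0 < 1 - r by rewrite subr_gt0.
(* With the factor [1 - r ^+ p] this is the exact partial geometric sum, which reproduces itself
   under induction on [p]. *)
suff H : `|u (n + p)%N - u n| <= A / (1 - r) * r ^+ n * (1 - r ^+ p).
  apply: (le_trans H); rewrite ler_piMr//.
    by rewrite mulr_ge0 ?exprn_ge0// divr_ge0// ltW.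
  by rewrite lerBlDr lerDl exprn_ge0.
elim: p => [|p IH]; first by rewrite addn0 subrr normr0 expr0 subrr mulr0.
rewrite addnS -(subrK (u (n + p)%N) (u (n + p).+1)) -addrA.
apply: (le_trans (ler_normD _ _)); apply: (le_trans (lerD (uA _) IH)).
rewrite le_eqVlt; apply/orP; left; apply/eqP.
by rewrite exprD exprS; field; rewrite gt_eqF.
Qed.

Lemma cvgn_of_geometric : cvgn u.
Proof.
have c : cvgn (series (telescope u)).
  apply: normed_cvg; apply: (@series_le_cvg _ _ (geometric A r)).
  - by move=> n; exact: normr_ge0.
  - by move=> n; rewrite /geometric/= mulr_ge0 ?exprn_ge0.
  - exact: uA.
  - by apply: is_cvg_geometric_series; rewrite ger0_norm.
rewrite telescopeK in c.
have -> : u = (fun n => (u n - u 0%N) + u 0%N) by apply/funext => n; rewrite subrK.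
by apply: is_cvgD => //; exact: is_cvg_cst.
Qed.

Lemma lim_geometric_bound n : `|limn u - u n| <= A / (1 - r) * r ^+ n.
Proof.
have h : (fun m => `|u m - u n|) @ \oo --> `|limn u - u n|.
  by apply: cvg_norm; apply: cvgB; [exact: cvgn_of_geometric|exact: cvg_cst].
apply: (cvgr_to_le h); exists n => // m /= nm.
by rewrite -(subnKC nm); exact: ud.
Qed.

End GeometricSequence.

Section Digits.
Context {b : nat} (hb : (2 <= b)%N).
Implicit Types (w : seq 'I_b).

Let b_gt0 : (0 < b)%N. Proof. exact: ltnW. Qed.

(** Base-[b] expansion of [i] on exactly [j] letters, most significant first, so that increasing [i]
    runs through the intervals of level [j] from left to right. An index [i >= b ^ j] loses its
    leading digits, hence the bounds in later lemmas. *)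
Fixpoint digits (j i : nat) : seq 'I_b :=
  if j is j'.+1 then rcons (digits j' (i %/ b)) (Ordinal (ltn_pmod i b_gt0))
  else [::].

Definition word_val w : nat := foldl (fun a (l : 'I_b) => a * b + l)%N 0%N w.

Lemma size_digits j i : size (digits j i) = j.
Proof. by elim: j i => //= j IH i; rewrite size_rcons IH. Qed.

Lemma digits_rcons j k (l : 'I_b) :
  digits j.+1 (k * b + l) = rcons (digits j k) l.
Proof.
rewrite /= divnMDl// divn_small// addn0; congr rcons.
by apply: val_inj; rewrite /= modnMDl modn_small.
Qed.

Lemma word_val_rcons w (l : 'I_b) : word_val (rcons w l) = (word_val w * b + l)%N.
Proof. by rewrite /word_val -cats1 foldl_cat. Qed.

Lemma word_val_lt w : (word_val w < b ^ size w)%N.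
Proof.
elim/last_ind: w => [//|w l IH]; rewrite word_val_rcons size_rcons expnSr.
by apply: leq_trans (leq_mul IH (leqnn b)); rewrite mulSn [ltnLHS]addnC ltn_add2r.
Qed.

Lemma word_valK w : digits (size w) (word_val w) = w.
Proof.
elim/last_ind: w => [//|w l IH].
by rewrite word_val_rcons size_rcons digits_rcons IH.
Qed.

Lemma word_left_rcons (R : realType) w (l : 'I_b) :
  word_left (rcons w l) = word_left w + l%:R * b%:R ^- (size w).+1 :> R.
Proof.
pose g v (k : nat) : R := (nth l v k)%:R * b%:R ^- k.+1.
have E v : word_left v = \sum_(0 <= k < size v) g v k :> R.
  rewrite big_mkord; apply: eq_bigr => k _; rewrite (tnth_nth l).
  by [].
rewrite !E size_rcons big_nat_recr//=; congr (_ + _).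
  by apply: eq_big_nat => k /andP[_ kw]; rewrite /g nth_rcons kw.
by rewrite /g nth_rcons ltnn eqxx.
Qed.

(** This places the interval of [w] on the lattice of step [b ^- size w], so that increments over
    consecutive intervals telescope. *)
Lemma word_left_val (R : realType) w :
  word_left w = (word_val w)%:R * b%:R ^- size w :> R.
Proof.
have bn0 : b%:R != 0 :> R by rewrite pnatr_eq0 -lt0n.
elim/last_ind: w => [|w l IH]; first by rewrite /word_left big_ord0 mul0r.
rewrite word_left_rcons IH word_val_rcons size_rcons natrD natrM mulrDl; congr (_ + _).
by rewrite exprS invfM mulrA mulfK.
Qed.

Lemma word_val_digits j i : (i < b ^ j)%N -> word_val (digits j i) = i.
Proof.
elim: j i => [|j IH] i /=; first by rewrite expn0 ltnS leqn0 => /eqP ->.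
move=> ij; rewrite word_val_rcons IH/= -?divn_eq//.
by rewrite ltn_divLR// mulnC -expnS.
Qed.

Lemma Delta_digits (R : realType) (f : R -> R) j i : (i < b ^ j)%N ->
  Delta f (digits j i) = f (i.+1%:R * b%:R ^- j) - f (i%:R * b%:R ^- j).
Proof.
move=> ij; rewrite /Delta /word_right word_left_val word_val_digits// size_digits.
by rewrite -[i.+1%:R]natr1 mulrDl mul1r.
Qed.

Lemma sum_Delta_digits (R : realType) (f : R -> R) j k : (k <= b ^ j)%N ->
  \sum_(0 <= i < k) Delta f (digits j i) = f (k%:R * b%:R ^- j) - f 0.
Proof.
move=> kj; have := @telescope_sumr R 0 k (fun i => f (i%:R * b%:R ^- j)) isT.
rewrite mul0r => <-; apply: eq_big_nat => i /andP[_ ik].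
by rewrite Delta_digits// (leq_trans ik).
Qed.

Lemma word_left_itv (R : realType) w : (word_left w : R) \in `[0, 1].
Proof.
rewrite in_itv/= word_left_val divr_ge0 ?exprn_ge0//=.
rewrite ler_pdivrMr ?exprn_gt0 ?ltr0n// mul1r -natrX ler_nat ltnW//.
exact: word_val_lt.
Qed.

Lemma word_right_itv (R : realType) w : (word_right w : R) \in `[0, 1].
Proof.
rewrite in_itv/= /word_right word_left_val addr_ge0 ?divr_ge0 ?invr_ge0 ?exprn_ge0//=.
rewrite -[X in _ + X <= _]mul1r -mulrDl natr1.
rewrite ler_pdivrMr ?exprn_gt0 ?ltr0n// mul1r -natrX ler_nat.
exact: word_val_lt.
Qed.

End Digits.

(** * Approximation of reals by b-adic lattice points *)

Section LatticeApproximation.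
Context {R : realType} {b : nat} (hb : (2 <= b)%N).
Implicit Types (t s : R).

(** For [t] in [[0, 1]], the number of level-[j] intervals contained in [[0, t]]; it equals [b ^ j]
    at [t = 1]. *)
Definition lattice_index (j : nat) (t : R) : nat := Num.truncn (b%:R ^+ j * t).

Let bj_gt0 j : 0 < b%:R ^+ j :> R.
Proof. by rewrite exprn_gt0// ltr0n ltnW. Qed.

Lemma lattice_index_le j t : t <= 1 -> (lattice_index j t <= b ^ j)%N.
Proof.
move=> t1; rewrite /lattice_index -(@natrK R (b ^ j)) natrX.
by apply: le_truncn; rewrite ler_piMr// ltW.
Qed.

Lemma lattice_index_nat j i k : (j <= i)%N ->
  lattice_index i (k%:R * b%:R ^- j) = (k * b ^ (i - j))%N.
Proof.
move=> ji; rewrite /lattice_index -[RHS](@natrK R); congr Num.truncn.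
by rewrite natrM natrX -[in LHS](subnKC ji) exprD; field; rewrite gt_eqF.
Qed.

Lemma lattice_index_div j t :
  (lattice_index j.+1 t %/ b)%N = lattice_index j t.
Proof.
have b0 : (0 < b)%N by exact: ltnW.
rewrite /lattice_index exprS -mulrA; set x := _ * t.
(* [primitive] is treated on the whole line, so negative [t] occurs; [Num.truncn] is 0 there. *)
have [x0|x0] := ltP x 0.
  have z y : y < 0 -> Num.truncn (y : R) = 0%N.
    by move=> y0; rewrite truncn_floor leNgt y0.
  by rewrite !z// ?div0n// pmulr_rlt0// ltr0n.
apply/esym/truncn_def.
have /truncn_itv/andP[h1 h2] : 0 <= b%:R * x by rewrite mulr_ge0.
have b0R : 0 < b%:R :> R by rewrite ltr0n.
apply/andP; split.
  rewrite -(ler_pM2l b0R) -natrM (le_trans _ h1)// ler_nat mulnC.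
  exact: leq_divM.
rewrite -(ltr_pM2l b0R) -natrM (lt_le_trans h2)// ler_nat mulnC.
exact: ltn_ceil.
Qed.

Lemma lattice_index_near j t s : `|t - s| < b%:R ^- j ->
  t <= s -> (lattice_index j t <= lattice_index j s <= (lattice_index j t).+1)%N.
Proof.
move=> ts tles; apply/andP; split.
  by apply: le_truncn; rewrite ler_pM2l.
rewrite truncn_le_nat.
have : b%:R ^+ j * s < b%:R ^+ j * t + 1.
  rewrite addrC -ltrBlDr -mulrBr -ltr_pdivlMl// mulr1 (le_lt_trans _ ts)//.
  by rewrite distrC ler_norm.
move=> h; apply: (lt_le_trans h).
by rewrite -natr1 lerD2r ltW// truncnS_gt.
Qed.

Lemma lattice_approx t : 0 <= t ->
  (lattice_index j t)%:R * b%:R ^- j @[j --> \oo] --> t.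
Proof.
move=> t0.
have b1 : b%:R^-1 < 1 :> R by rewrite invf_lt1 ?ltr0n ?ltr1n// ltnW.
have c : b%:R^-1 ^+ j @[j --> \oo] --> (0 : R).
  by apply: cvg_expr; rewrite ger0_norm.
apply: (@squeeze_cvgr _ _ _ _ (fun j => t - b%:R^-1 ^+ j) (cst t)); last exact: cvg_cst.
  apply: nearW => j; have /andP[h1 h2] := truncn_itv (mulr_ge0 (ltW (bj_gt0 j)) t0).
  rewrite exprVn lerBlDr -[X in _ <= _ + X]mul1r -mulrDl natr1.
  by rewrite ler_pdivlMr// ler_pdivrMr// ![t * _]mulrC (ltW h2).
by rewrite -[X in _ --> X]subr0; apply: cvgB => //; exact: cvg_cst.
Qed.

(** The increments telescope to the value of [f] at the lattice point just below [t]. Continuity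
    holds only within [[0, 1]], so these points must be shown to stay there. *)
Lemma lattice_sum_Delta (f : R -> R) t : {within `[0, 1], continuous f} ->
  t \in `[0, 1] ->
  \sum_(0 <= i < lattice_index j t) Delta f (digits hb j i) @[j --> \oo] --> f t - f 0.
Proof.
move=> cf t01; have /andP[t0 t1] : 0 <= t <= 1 by rewrite in_itv/= in t01.
under eq_cvg => j do rewrite (sum_Delta_digits hb) ?lattice_index_le//.
apply: cvgB; last exact: cvg_cst.
move/subspace_continuousP : cf => /(_ t t01) ft.
pose u j : R := (lattice_index j t)%:R * b%:R ^- j.
suff h : u @ \oo --> within `[0, 1] (nbhs t) by exact: (cvg_comp _ _ h ft).
move=> A hA; have h2 : \forall j \near \oo, u j \in `[0, 1] -> A (u j).
  exact: (lattice_approx t0 hA).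
change (\forall j \near \oo, A (u j)); apply: filterS h2 => j; apply.
rewrite /u in_itv/= mulr_ge0 ?invr_ge0 ?(ltW (bj_gt0 j))//=.
by rewrite ler_pdivrMr// mul1r -natrX ler_nat lattice_index_le.
Qed.

End LatticeApproximation.

(** * Continuous primitive of an additive function with geometric decay *)

Section Primitive.
Context {R : realType} {b : nat} (hb : (2 <= b)%N).
Variable m : seq 'I_b -> R.

Definition lattice_sum (j k : nat) : R := \sum_(0 <= i < k) m (digits hb j i).

Definition primitive (t : R) : R :=
  limn (fun j => lattice_sum j (@lattice_index R b j t)).

Variables (C r : R).
Hypotheses (r0 : 0 <= r) (r1 : r < 1).
Hypothesis m_bound : forall w, `|m w| <= C * r ^+ size w.
Hypothesis m_add : forall w, m w = \sum_(l < b) m (rcons w l).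

(** The children of the interval of index [k] have the [b] consecutive indices starting at [k * b],
    so additivity matches the sums block by block. *)
Lemma lattice_sumM j k : lattice_sum j.+1 (k * b) = lattice_sum j k.
Proof.
elim: k => [|k IH]; first by rewrite /lattice_sum mul0n !big_geq.
rewrite [RHS]/lattice_sum big_nat_recr// -/(lattice_sum j k) -IH /lattice_sum.
rewrite (@big_cat_nat _ _ _ (k * b)%N)//; last by rewrite leq_mul2r leqnSn orbT.
congr (_ + _); rewrite m_add -[X in \sum_(X <= _ < _) _]add0n mulSn big_addn addnK.
rewrite big_mkord; apply: eq_bigr => l _.
by rewrite [(_ + k * b)%N]addnC digits_rcons.
Qed.

Lemma lattice_sumX j i k : (j <= i)%N ->
  lattice_sum i (k * b ^ (i - j)) = lattice_sum j k.
Proof.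
move=> ji; rewrite -{1}(subnKC ji).
elim: (i - j)%N => [|p IH]; first by rewrite addn0 expn0 muln1.
by rewrite addnS expnSr mulnA lattice_sumM.
Qed.

Let C0 : 0 <= C.
Proof. by have := m_bound [::]; rewrite expr0 mulr1; exact: le_trans. Qed.

Let lattice_sum_step j k k' : (k <= k')%N ->
  `|lattice_sum j k' - lattice_sum j k| <= (k' - k)%:R * (C * r ^+ j).
Proof.
move=> kk'; rewrite /lattice_sum (@big_cat_nat _ _ _ k)//= addrAC subrr add0r.
apply: (le_trans (ler_norm_sum _ _ _)).
have -> : (k' - k)%:R * (C * r ^+ j) = \sum_(k <= i < k') (C * r ^+ j).
  by rewrite sumr_const_nat mulr_natl.
by apply: ler_sum => i _; rewrite (le_trans (m_bound _))// size_digits.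
Qed.

(** The index at level [j + 1] exceeds [b] times the index at level [j] by a remainder less than
    [b], and each extra interval costs at most [C * r ^+ j.+1]. *)
Let primitive_step t j :
  `|lattice_sum j.+1 (@lattice_index R b j.+1 t) - lattice_sum j (@lattice_index R b j t)|
  <= (b%:R * C * r) * r ^+ j.
Proof.
rewrite -(lattice_index_div hb j) -(lattice_sumM j); set k := @lattice_index R b j.+1 t.
apply: (le_trans (lattice_sum_step j.+1 (leq_divM k b))).
rewrite exprS -!mulrA ler_wpM2r ?mulr_ge0 ?exprn_ge0//.
rewrite ler_nat {1}(divn_eq k b) addKn ltnW// ltn_mod ltnW//.
Qed.

Lemma primitive_cvg t :
  lattice_sum j (@lattice_index R b j t) @[j --> \oo] --> primitive t.
Proof. exact: (cvgn_of_geometric r0 r1 (primitive_step t)). Qed.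

Let primitive_approx t j :
  `|primitive t - lattice_sum j (@lattice_index R b j t)| <=
  (b%:R * C * r) / (1 - r) * r ^+ j.
Proof. exact: (lim_geometric_bound r0 r1 (primitive_step t)). Qed.

(** At a lattice point of level [j] the approximating sequence is constant from rank [j] on, which
    makes the increments exact. *)
Lemma primitive_lattice j k : primitive (k%:R * b%:R ^- j) = lattice_sum j k.
Proof.
apply/cvg_lim => //; apply: cvg_near_cst; exists j => // i /= ji.
by rewrite lattice_index_nat// lattice_sumX.
Qed.

Lemma primitive0 : primitive 0 = 0.
Proof.
by have := primitive_lattice 0 0; rewrite mul0r => ->; rewrite /lattice_sum big_geq.
Qed.

Lemma Delta_primitive w : Delta primitive w = m w.
Proof.
rewrite -{1}(word_valK hb w) Delta_digits ?word_val_lt// !primitive_lattice.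
by rewrite /lattice_sum big_nat_recr//= addrAC subrr add0r word_valK.
Qed.

Lemma primitive_continuous : continuous primitive.
Proof.
set D := (b%:R * C * r) / (1 - r).
have D0 : 0 <= D.
  by rewrite /D divr_ge0 ?mulr_ge0// subr_ge0 ltW.
(* The indices of [t] and [s] differ by at most one: that interval costs [C], and replacing either
   value of [primitive] by its level-[j] sum costs [D], all times [r ^+ j]. *)
have H j (t s : R) : `|t - s| < b%:R ^- j -> t <= s ->
    `|primitive t - primitive s| <= (C + D + D) * r ^+ j.
  move=> ts tles; have /andP[h1 h2] := lattice_index_near hb ts tles.
  have h3 := primitive_approx t j; have h4 := primitive_approx s j.
  have h5 : `|lattice_sum j (@lattice_index R b j s) - lattice_sum j (@lattice_index R b j t)|
      <= C * r ^+ j.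
    apply: (le_trans (lattice_sum_step j h1)).
    rewrite -[leRHS]mul1r ler_wpM2r ?mulr_ge0 ?exprn_ge0// lern1.
    by rewrite leq_subLR addn1.
  rewrite -/D in h3 h4.
  by move: h3 h4 h5; rewrite !ler_norml !mulrDl; lra.
move=> t; apply/cvgrPdist_le => e e0.
have c : (C + D + D) * r ^+ j @[j --> \oo] --> (0 : R).
  rewrite -[X in _ --> X](mulr0 (C + D + D)); apply: cvgMl_tmp.
  by apply: cvg_expr; rewrite ger0_norm.
have [j _ /(_ j (leqnn _)) /= hj] := cvgr_le _ c _ e0.
near=> s.
have ts : `|t - s| < b%:R ^- j.
  near: s; have : s @[s --> t] --> t by exact: cvg_id.
  by move/cvgrPdist_lt; apply; rewrite invr_gt0 exprn_gt0// ltr0n ltnW.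
apply: le_trans hj; have [tles|/ltW slet] := leP t s; first exact: H.
by rewrite distrC; apply: H => //; rewrite distrC.
Unshelve. all: end_near. Qed.

End Primitive.

(** * Almost sure bounds and measurability *)

Lemma norm_le_sqrt_geometric (R : realType) (y C q : R) (n : nat) :
  0 <= C -> 0 <= q -> y ^+ 2 <= C * q ^+ n ->
  `|y| <= Num.sqrt C * Num.sqrt q ^+ n.
Proof.
move=> C0 q0 yC.
rewrite -(ler_pXn2r (n := 2))// ?nnegrE ?mulr_ge0 ?exprn_ge0 ?sqrtr_ge0//.
by rewrite real_normK ?num_real// exprMn sqr_sqrtr// -exprM mulnC exprM sqr_sqrtr.
Qed.

Section AlmostEverywhere.
Context {d} {T : measurableType d} {R : realType}.

Lemma ae_forall_countable (mu : {measure set T -> \bar R}) (I : countType)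
    (Q : I -> T -> Prop) :
  (forall i, {ae mu, forall w, Q i w}) -> {ae mu, forall w i, Q i w}.
Proof.
move=> QI.
have : {ae mu, forall w n, if unpickle n is Some i then Q i w else True}.
  apply: ae_foralln => n; case: unpickle => [i|]; first exact: QI.
  exact: aeW.
by apply: filterS => w + i => /(_ (pickle i)); rewrite pickleK.
Qed.

(** The convergence set [G] is measurable by the Cauchy criterion with countably many tolerances.
    Off [G], [limn] is the constant [point], so the sequence replaced by [point] there converges
    everywhere to [limn]. *)
Lemma measurable_limn (u : nat -> T -> R) :
  (forall n, measurable_fun setT (u n)) ->
  measurable_fun setT (fun w => limn (u ^~ w)).
Proof.
move=> mu_.
pose G := [set w | cvgn (u ^~ w)].
have GE : G = \bigcap_k \bigcup_N \bigcap_(m in [set m | (N <= m)%N])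
    [set w | `|u m w - u N w| < k.+1%:R^-1].
  apply/seteqP; split => [w Gw k _|w h].
    have k0 : 0 < k.+1%:R^-1 / 2 :> R by rewrite divr_gt0.
    have /cvgrPdist_lt/(_ _ k0)[N _ hN] := Gw.
    exists N => // m /= Nm.
    have h1 := hN m Nm; have h2 := hN N (leqnn N).
    rewrite [ltRHS](splitr k.+1%:R^-1) -(subrKA (limn (u ^~ w))).
    by apply: (le_lt_trans (ler_normD _ _)); apply: ltrD => //; rewrite distrC.
  apply/cauchy_cvgP/cauchy_exP => _/posnumP[e].
  have [N _ hN] := h (Num.bound e%:num^-1) I.
  exists (u N w); exists N => // m /= Nm; rewrite -ball_normE /= distrC.
  apply: (lt_le_trans (hN m Nm)).
  rewrite -[leRHS]invrK lef_pV2 ?posrE ?invr_gt0//.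
  rewrite ltW// (lt_le_trans (archi_boundP _))// ler_nat//.
have mG : measurable G.
  rewrite GE; apply: bigcapT_measurable => k; apply: bigcupT_measurable => N.
  apply: bigcap_measurableType => m _.
  rewrite -[X in measurable X]setTI.
  apply: (@measurable_fun_ltr _ _ _ setT (fun w => `|u m w - u N w|) (cst k.+1%:R^-1)
    _ _ measurableT [set true]) => //.
  by apply: measurableT_comp => //; exact: measurable_funB.
apply: (measurable_fun_cvg (h := fun n w => if w \in G then u n w else point)).
  move=> n; apply: measurable_fun_ifT => //.
  rewrite (_ : (fun w => w \in G) = (fun w => (\1_G w : R) == 1)); last first.
    by apply/funext => w; rewrite indicE; case: (w \in G); rewrite ?eqxx// eq_sym oner_eq0.
  by apply: measurable_fun_eqr => //; exact: measurable_indic.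
move=> w _; case: (boolP (w \in G)) => [|/negP]; rewrite inE => Gw //.
by rewrite dvgP//; exact: cvg_cst.
Qed.

(** The series of [r ^- j * Z j] has expectation at most [A / (1 - q / r)]; it is therefore almost
    surely finite, and its sum serves as [C]. *)
Lemma ae_geometric_bound (P : probability T R) (Z : nat -> T -> R) (A q r : R) :
  0 <= q -> q < r ->
  (forall j, measurable_fun setT (Z j)) -> (forall j w, 0 <= Z j w) ->
  (forall j, \int[P]_w (Z j w)%:E <= (A * q ^+ j)%:E)%E ->
  {ae P, forall w, exists C, forall j, Z j w <= C * r ^+ j}.
Proof.
move=> q0 qr mZ Z0 ZA.
have r0 : 0 < r by exact: le_lt_trans qr.
pose f j w : \bar R := (r ^- j * Z j w)%:E.
have f0 j w : (0 <= f j w)%E by rewrite lee_fin mulr_ge0// invr_ge0 exprn_ge0// ltW.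
have mf j : measurable_fun setT (f j).
  by apply/measurable_EFinP; exact: measurable_funM.
have A0 : 0 <= A.
  have := ZA 0; rewrite expr0 mulr1 -lee_fin; apply: le_trans.
  by apply: integral_ge0 => w _; rewrite lee_fin.
have qr1 : `|q / r| < 1 by rewrite ger0_norm ?divr_ge0 ?(ltW r0)// ltr_pdivrMr// mul1r.
have fint : (\int[P]_w (\sum_(j <oo) f j w) < +oo)%E.
  rewrite integral_nneseries//.
  apply: (@le_lt_trans _ _ (\sum_(j <oo) (geometric A (q / r) j)%:E)%E).
    apply: lee_nneseries => [j _ _|j _].
      by apply: integral_ge0.
    rewrite /f; under eq_integral do rewrite EFinM.
    rewrite ge0_integralZl_EFin//; last 3 first.
    - by move=> w _; rewrite lee_fin.
    - exact/measurable_EFinP.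
    - by rewrite invr_ge0 exprn_ge0// ltW.
    apply: (le_trans (lee_wpmul2l _ (ZA j))).
      by rewrite lee_fin invr_ge0 exprn_ge0// ltW.
    by rewrite -EFinM lee_fin /geometric/= exprMn exprVn mulrC mulrA.
  have qr0 : 0 <= q / r by rewrite divr_ge0 ?(ltW r0).
  have g0 j : (0 <= (geometric A (q / r) j)%:E)%E.
    by rewrite lee_fin /geometric/= mulr_ge0// exprn_ge0.
  apply: (@le_lt_trans _ _ (A / (1 - q / r))%:E); last exact: ltry.
  apply: lime_le; first exact: is_cvg_nneseries.
  apply: nearW => n; rewrite sumEFin lee_fin.
  have x1 : q / r < 1 by rewrite ltr_pdivrMr// mul1r.
  have /(congr1 (fun f => f n)) := @geometric_seriesE R A (q / r) (negbT (lt_eqF x1)).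
  rewrite seriesEnat/= => ->.
  by rewrite ler_pM2r ?invr_gt0 ?subr_gt0// ler_piMr// lerBlDr lerDl exprn_ge0.
have mS : measurable_fun setT (fun w => \sum_(j <oo) f j w)%E.
  apply: ge0_emeasurable_sum => //.
have iS : P.-integrable setT (fun w => \sum_(j <oo) f j w)%E.
  apply/integrableP; split => //.
  under eq_integral do rewrite gee0_abs ?nneseries_ge0//.
  exact: fint.
have := integrable_ae measurableT iS.
apply: filterS => w /(_ I) Sw.
exists (fine (\sum_(j <oo) f j w)%E) => j.
rewrite -ler_pdivrMr ?exprn_gt0// mulrC -lee_fin fineK// -/(f j w).
have := @nneseries_lim_ge R (f ^~ w) xpredT 0 j.+1 (fun n _ _ => f0 n w).
apply: le_trans; rewrite big_nat_recr//=.
by apply: leeDr; exact: sume_ge0.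
Qed.

End AlmostEverywhere.

(** * Enumeration of finite words and sums over them *)

Section Words.
Context {b : nat}.
Implicit Types (w u v : seq 'I_b).

Definition level (k : nat) : seq (seq 'I_b) :=
  map (@tval k 'I_b) (enum {: k.-tuple 'I_b}).

(** The empty word is left out, so every member indexes one of the independent variables. *)
Fixpoint words (L : nat) : seq (seq 'I_b) :=
  if L is L'.+1 then words L' ++ level L else [::].

Lemma mem_level k u : (u \in level k) = (size u == k).
Proof.
apply/mapP/eqP => [[v _ ->]|uk]; first exact: size_tuple.
by exists (Tuple (introT eqP uk)) => //; rewrite mem_enum.
Qed.

Lemma level_uniq k : uniq (level k).
Proof. by rewrite map_inj_uniq ?enum_uniq//; exact: val_inj. Qed.

Lemma size_level k : size (level k) = (b ^ k)%N.
Proof. by rewrite size_map -cardE card_tuple card_ord. Qed.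

Lemma mem_words L u : (u \in words L) = (0 < size u <= L)%N.
Proof.
elim: L => [|L IH]; first by rewrite in_nil leqn0 andbC; case: eqP => // ->.
rewrite mem_cat IH mem_level; case: ltngtP => //=; lia.
Qed.

Lemma words_uniq L : uniq (words L).
Proof.
elim: L => //= L IH; rewrite cat_uniq IH level_uniq andbT/=.
by apply/hasPn => u; rewrite mem_level mem_words => /eqP ->; rewrite ltnn andbF.
Qed.

Section Sums.
Context {V : nmodType}.
Implicit Types (f : seq 'I_b -> V).

Lemma sum_tuple f k : \sum_(v : k.-tuple 'I_b) f v = \sum_(u <- level k) f u.
Proof. by rewrite big_map big_enum. Qed.

Lemma sum_words f L :
  \sum_(u <- words L) f u = \sum_(1 <= k < L.+1) \sum_(u <- level k) f u.
Proof.
elim: L => [|L IH]; first by rewrite big_nil big_geq.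
by rewrite big_cat IH [RHS]big_nat_recr.
Qed.

Lemma sum_level_pred1 f k w : size w = k ->
  \sum_(u <- level k | u == w) f u = f w.
Proof. 
move=> wk; rewrite -big_filter filter_pred1_uniq ?level_uniq ?big_seq1//.
by rewrite mem_level wk. Qed.

Lemma sum_level_prefix f k w :
  \sum_(u <- level (size w + k) | take (size w) u == w) f u =
  \sum_(v <- level k) f (w ++ v).
Proof.
rewrite -big_filter -(big_map (cat w) xpredT f); apply: perm_big.
apply: uniq_perm; first by rewrite filter_uniq// level_uniq.
  by rewrite map_inj_uniq ?level_uniq// => u v /eqP; rewrite eqseq_cat// eqxx => /eqP.
move=> u; rewrite mem_filter mem_level; apply/andP/mapP => [[/eqP tu /eqP su]|[v vk ->]].
  exists (drop (size w) u); last by rewrite -{1}tu cat_take_drop.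
  by rewrite mem_level size_drop su addKn.
by move: vk; rewrite mem_level take_size_cat// eqxx size_cat => /eqP ->.
Qed.

Lemma sum_level_cons f k :
  \sum_(u <- level k.+1) f u = \sum_(l < b) \sum_(v <- level k) f (l :: v).
Proof.
rewrite (eq_bigr (fun l => \sum_(v <- level k) f ([:: l] ++ v)))//.
rewrite (eq_bigr (fun l => \sum_(u <- level k.+1 | take 1 u == [:: l]) f u)); last first.
  by move=> l _; rewrite -(sum_level_prefix f k [:: l]).
rewrite (exchange_big_dep xpredT)//= big_seq [RHS]big_seq; apply: eq_bigr => -[|l u].
  by rewrite mem_level.
by move=> _; rewrite /= take0 (big_pred1 l)// => l'; rewrite eqseq_cons eqxx andbT eq_sym.
Qed.

End Sums.

(** Prefixes agree exactly up to the longest common one. This count is how [lcp] enters the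
    covariance. *)
Lemma sum_take_eq (w w' : seq 'I_b) : size w = size w' ->
  (\sum_(1 <= k < (size w).+1) (take k w == take k w') = size (lcp w w'))%N.
Proof.
elim: w w' => [|l w IH] [|l' w']//= => [|[sw]]; first by rewrite big_geq.
rewrite big_add1/=; case: eqVneq => [<-|ll'].
  rewrite big_nat_recl//= ?take0 ?eqxx -IH// big_add1/= add1n; congr _.+1.
  by apply: eq_bigr => k _; rewrite eqseq_cons eqxx.
rewrite big1// => k _ /=; rewrite eqseq_cons (negbTE ll')//.
Qed.

End Words.

Section Span.
Context {T : Type} {R : numDomainType} {I : choiceType}.
Variables (D : set I) (X : I -> T -> R).

(** An index may occur several times in the list, so closure under sums is mere concatenation. *)
Definition in_span (Y : T -> R) : Prop :=
  exists s : seq (R * I), (forall p, p \in s -> D p.2) /\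
    Y = (fun w => \sum_(p <- s) p.1 * X p.2 w).

Lemma in_span_gen i : D i -> in_span (X i).
Proof.
move=> Di; exists [:: (1, i)]; split; first by move=> p /[!inE] /eqP ->.
by apply/funext => w; rewrite big_seq1 mul1r.
Qed.

Lemma in_span_scale c Y : in_span Y -> in_span (fun w => c * Y w).
Proof.
move=> [s [sD ->]]; exists [seq (c * p.1, p.2) | p <- s]; split.
  by move=> _ /mapP[p ps ->] /=; exact: sD.
by apply/funext => w; rewrite big_map mulr_sumr; apply: eq_bigr => p _; rewrite mulrA.
Qed.

Lemma in_span_add Y Z : in_span Y -> in_span Z -> in_span (fun w => Y w + Z w).
Proof.
move=> [s [sD ->]] [t [tD ->]]; exists (s ++ t); split.
  by move=> p; rewrite mem_cat => /orP[/sD|/tD].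
by apply/funext => w; rewrite big_cat.
Qed.

Lemma in_span_sum (J : eqType) (s : seq J) (Y : J -> T -> R) :
  (forall j, j \in s -> in_span (Y j)) -> in_span (fun w => \sum_(j <- s) Y j w).
Proof.
elim: s => [_|j s IH H].
  exists [::]; split => //; apply/funext => w; by rewrite !big_nil.
rewrite (_ : (fun w => _) = (fun w => Y j w + \sum_(j <- s) Y j w)).
  apply: in_span_add; first by apply: H; rewrite mem_head.
  by apply: IH => i si; apply: H; rewrite in_cons si orbT.
by apply/funext => w; rewrite big_cons.
Qed.

End Span.

(** Independence requires distinct indices: the coefficients of repeated indices are added up before
    [indep_normal_sum] is applied. *)
Lemma in_span_law {d} {T : measurableType d} {R : realType} (P : probability T R)
    (I : choiceType) (D : set I) (X : I -> T -> R) (Y : T -> R) :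
  mutually_independent P D X ->
  (forall i, D i -> has_law P (X i) (normal_prob 0 1)) ->
  in_span D X Y -> exists s, has_law P Y (centered_normal s).
Proof.
move=> Xi Xl [s [sD ->]].
pose J := undup (unzip2 s); pose c i : R := \sum_(p <- s | p.2 == i) p.1.
exists (Num.sqrt (\sum_(i <- J) c i ^+ 2)).
rewrite (_ : (fun w => _) = (fun w => \sum_(i <- J) c i * X i w)).
  apply: (indep_normal_sum Xi Xl); first exact: undup_uniq.
  by move=> i; rewrite mem_undup => /mapP[p ps ->]; exact: sD.
apply/funext => w; under [RHS]eq_bigr do rewrite mulr_suml.
rewrite (exchange_big_dep xpredT)//= big_seq [RHS]big_seq; apply: eq_bigr => p ps.
rewrite (eq_bigl (fun i => i == p.2)); last by move=> i; rewrite eq_sym.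
rewrite -big_filter filter_pred1_uniq ?undup_uniq ?big_seq1// mem_undup.
by apply/mapP; exists p.
Qed.

(** * The cascade *)

Lemma cvg_sumr {R : realType} (J : Type) (s : seq J) (f : J -> nat -> R) (l : J -> R) :
  (forall j, f j n @[n --> \oo] --> l j) ->
  \sum_(j <- s) f j n @[n --> \oo] --> \sum_(j <- s) l j.
Proof.
move=> fl; elim: s => [|j s IH].
  by rewrite big_nil; under eq_cvg do rewrite big_nil; exact: cvg_cst.
by rewrite big_cons; under eq_cvg do rewrite big_cons; exact: cvgD.
Qed.

Section CascadeLaws.
Context {d} {T : measurableType d} {R : realType} (P : probability T R).
Context {b : nat} (hb : (2 <= b)%N) (xi : seq 'I_b -> T -> R).
Hypothesis xi_indep : mutually_independent P [set w | w != [::]] xi.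
Hypothesis xi_law : forall w : seq 'I_b, w != [::] ->
  has_law P (xi w) (normal_prob 0 1).
Implicit Types (w u v : seq 'I_b) (omega : T).
Local Notation nonempty := [set w : seq 'I_b | w != [::]].
Local Notation M := (cylinder_mass xi).
Local Notation B := (b%:R : R).

Let b_gt0 : 0 < B. Proof. by rewrite ltr0n ltnW. Qed.
Let b_ge2 : 2 <= B. Proof. by rewrite ler_nat. Qed.
Let b_ge1 : 1 <= B. Proof. by rewrite ler1n ltnW. Qed.
Let bn0 : B != 0. Proof. by rewrite gt_eqF. Qed.
Let b1_gt0 : 0 < B - 1. Proof. by rewrite subr_gt0 ltr1n. Qed.
Let b1n0 : B - 1 != 0. Proof. by rewrite gt_eqF. Qed.

Definition partial_mass (n : nat) w omega : R :=
  B ^- size w * Num.sqrt (B - 1) *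
  (tail_sum xi w omega n + \sum_(1 <= k < (size w).+1) xi (take k w) omega).

Let span_law Y : in_span nonempty xi Y -> exists s, has_law P Y (centered_normal s).
Proof. by move=> Ys; apply: (in_span_law xi_indep) Ys. Qed.

Let span_measurable Y : in_span nonempty xi Y -> measurable_fun setT Y.
Proof. by move=> /span_law[s []]. Qed.

Let tail_sum_span n w : in_span nonempty xi (fun omega => tail_sum xi w omega n).
Proof.
apply: in_span_sum => k; rewrite mem_index_iota => /andP[k0 _].
apply: in_span_sum => v _; apply: in_span_scale; apply: in_span_gen => /=.
by rewrite -size_eq0 size_cat size_tuple -lt0n ltn_addl.
Qed.

Let partial_mass_span n w : in_span nonempty xi (partial_mass n w).
Proof.
apply: in_span_scale; apply: in_span_add; first exact: tail_sum_span.
apply: in_span_sum => k; rewrite mem_index_iota => /andP[k0 kw].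
apply: in_span_gen => /=.
by rewrite -size_eq0 size_takel// -lt0n.
Qed.

(** Level [k] of the tail has [b ^ k] terms of variance [b ^- (2 * k)], hence total variance
    [b ^- k], which is geometric. *)
Lemma tail_sum_cvg_ae : {ae P, forall omega w, cvgn (tail_sum xi w omega)}.
Proof.
apply: ae_forall_countable => w.
pose Y k omega := \sum_(v : k.+1.-tuple 'I_b) B ^- k.+1 * xi (w ++ v) omega.
have Y_law k : has_law P (Y k) (centered_normal (Num.sqrt (B ^- k.+1))).
  pose c (u : seq 'I_b) : R := B ^- k.+1.
  pose J := [seq w ++ v | v <- level k.+1].
  have -> : B ^- k.+1 = \sum_(i <- J) c i ^+ 2.
    rewrite big_map -(big_map (fun=> tt) xpredT (fun=> B ^- k.+1 ^+ 2)) big_const_seq.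
    rewrite count_predT size_map size_level iter_addr_0 -[RHS]mulr_natl natrX.
    by rewrite expr2 mulrA divff ?mul1r// expf_neq0.
  rewrite (_ : Y k = (fun omega => \sum_(i <- J) c i * xi i omega)); last first.
    apply/funext => omega; rewrite big_map /Y.
    by rewrite (sum_tuple (fun v => B ^- k.+1 * xi (w ++ v) omega)).
  apply: (indep_normal_sum xi_indep xi_law).
    by rewrite map_inj_uniq ?level_uniq// => u v /eqP; rewrite eqseq_cat// eqxx => /eqP.
  move=> _ /mapP[v + ->] /=; rewrite mem_level => vk.
  by rewrite -size_eq0 size_cat (eqP vk) addnS.
have mY k : measurable_fun setT (Y k) by have [] := Y_law k.
(* [Y k] collects the words of length [k + 1], and [b >= 2] gives the ratio 1/2; the 3/4 used below
   is an arbitrary choice strictly between 1/2 and 1. *)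
have Y_int k : (\int[P]_omega (Y k omega ^+ 2)%:E <= (1 * (1 / 2) ^+ k)%:E)%E.
  rewrite (centered_normal_sqr (Y_law k)) sqr_sqrtr ?invr_ge0 ?exprn_ge0// lee_fin.
  rewrite mul1r div1r exprVn lef_pV2 ?posrE ?exprn_gt0// exprS.
  rewrite -[leLHS]mul1r ler_pM ?exprn_ge0//.
  by rewrite lerXn2r ?nnegrE.
have := ae_geometric_bound (r := 3 / 4) _ _ (fun k => measurable_funX 2 (mY k)) _ Y_int.
have h1 : 0 <= 1 / 2 :> R by lra.
have h2 : 1 / 2 < 3 / 4 :> R by lra.
move=> /(_ h1 h2 (fun _ _ => sqr_ge0 _)); apply: filterS => omega [C HC].
have C0 : 0 <= C.
  by have := HC 0%N; rewrite expr0 mulr1; apply: le_trans; exact: sqr_ge0.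
apply: (@cvgn_of_geometric _ _ (Num.sqrt C) (Num.sqrt (3 / 4))).
- exact: sqrtr_ge0.
- by rewrite -[ltRHS]sqrtr1 ltr_sqrt//; lra.
move=> n; rewrite /tail_sum big_nat_recr//= addrAC subrr add0r.
apply: norm_le_sqrt_geometric => //; exact: HC.
Qed.

Lemma measurable_cylinder_mass w : measurable_fun setT (M w).
Proof.
apply: measurable_funM => //; apply: measurable_funD.
  apply: measurable_limn => n; exact/span_measurable/tail_sum_span.
apply: span_measurable; apply: in_span_sum => k; rewrite mem_index_iota => /andP[k0 kw].
apply: in_span_gen => /=.
by rewrite -size_eq0 size_takel// -lt0n.
Qed.

Lemma partial_mass_cvg_ae :
  {ae P, forall omega w, partial_mass n w omega @[n --> \oo] --> M w omega}.
Proof.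
apply: filterS tail_sum_cvg_ae => omega H w.
apply: cvgM; first exact: cvg_cst.
by apply: cvgD; [exact: H|exact: cvg_cst].
Qed.

(** Words of different lengths may be combined; the deviation is left unspecified and comes from
    [centered_normal_closed]. *)
Lemma mass_span_law Y : in_span setT M Y -> exists s, has_law P Y (centered_normal s).
Proof.
move=> [s [_ ->]].
pose Y_ n omega := \sum_(p <- s) p.1 * partial_mass n p.2 omega.
have Y_law n : exists sg, has_law P (Y_ n) (centered_normal sg).
  apply: span_law; apply: in_span_sum => p _; apply: in_span_scale.
  exact: partial_mass_span.
have [sg Y_sg] := choice Y_law.
apply: (centered_normal_closed Y_sg).
  apply: measurable_sum => p; apply: measurable_funM => //.
  exact: measurable_cylinder_mass.
apply: filterS partial_mass_cvg_ae => omega H.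
apply: cvg_sumr => p; apply: cvgM; first exact: cvg_cst.
exact: H.
Qed.

(** A word strictly below [w] is a child of [w] or lies below one; splitting off that first letter
    costs a factor [B^-1]. *)
Lemma tail_sumS w omega n : tail_sum xi w omega n.+1 =
  \sum_(l < b) B^-1 * (xi (rcons w l) omega + tail_sum xi (rcons w l) omega n).
Proof.
rewrite /tail_sum big_nat_recl//=.
rewrite (sum_tuple (fun v => B ^- 1 * xi (w ++ v) omega)) sum_level_cons.
transitivity (\sum_(l < b) \sum_(v <- level 0) B ^- 1 * xi (w ++ l :: v) omega +
  \sum_(l < b) \sum_(1 <= k < n.+1) \sum_(v <- level k) B ^- k.+1 * xi (w ++ l :: v) omega).
  congr (_ + _); rewrite exchange_big/=; apply: eq_bigr => k _.
  by rewrite (sum_tuple (fun v => B ^- k.+1 * xi (w ++ v) omega)) sum_level_cons.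
rewrite -big_split/=; apply: eq_bigr => l _.
rewrite mulrDr; congr (_ + _).
  rewrite (_ : level 0 = [:: [::]]); last first.
    apply: perm_small_eq => //; apply: uniq_perm; rewrite ?level_uniq// => u.
    by rewrite mem_level inE size_eq0.
  by rewrite big_seq1 cats1 expr1.
rewrite mulr_sumr; apply: eq_bigr => k _.
rewrite (sum_tuple (fun v => B ^- k * xi (rcons w l ++ v) omega)) mulr_sumr.
by apply: eq_bigr => v _; rewrite cat_rcons exprS invfM mulrA.
Qed.

Lemma cylinder_mass_additive_ae :
  {ae P, forall omega w, M w omega = \sum_(l < b) M (rcons w l) omega}.
Proof.
apply: filterS tail_sum_cvg_ae => omega H w.
have limE : limn (tail_sum xi w omega) =
    \sum_(l < b) B^-1 * (xi (rcons w l) omega + limn (tail_sum xi (rcons w l) omega)).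
  apply/cvg_lim => //; rewrite -(cvg_shiftS (tail_sum xi w omega)).
  rewrite (_ : [sequence _]_n = (fun n => \sum_(l < b) B^-1 *
      (xi (rcons w l) omega + tail_sum xi (rcons w l) omega n))); last first.
    by apply/funext => n; exact: tail_sumS.
  apply: cvg_sumr => l; apply: cvgM; first exact: cvg_cst.
  by apply: cvgD; [exact: cvg_cst|exact: H].
rewrite /cylinder_mass limE.
(* Summed over the [b] children, the factor [B^-1] restores the prefix sum of [w], while
   [xi (rcons w l)] becomes the last term of the prefix sum of the child. *)
transitivity (\sum_(l < b) B ^- size w * Num.sqrt (B - 1) *
  (B^-1 * (xi (rcons w l) omega + limn (tail_sum xi (rcons w l) omega) +
           \sum_(1 <= k < (size w).+1) xi (take k w) omega))).
  rewrite -[RHS]mulr_sumr; congr (_ * _); under [RHS]eq_bigr do rewrite mulrDr.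
  rewrite big_split/=; congr (_ + _).
  by rewrite sumr_const card_ord -[RHS]mulr_natl mulrA divff// mul1r.
apply: eq_bigr => l _; rewrite size_rcons [in RHS]big_nat_recr//=.
rewrite [take (size w).+1 _]take_oversize ?size_rcons//.
rewrite (@eq_big_nat _ _ _ 1 (size w).+1 (fun k => xi (take k (rcons w l)) omega)
   (fun k => xi (take k w) omega)); last first.
  by move=> k /andP[_ kw]; rewrite -cats1 takel_cat.
by rewrite exprS invfM; ring.
Qed.

End CascadeLaws.

Lemma centered_normal_ae {d} {T : measurableType d} {R : realType}
    (P : probability T R) (X Y : T -> R) (s : R) :
  has_law P X (centered_normal s) -> measurable_fun setT Y ->
  {ae P, forall omega, X omega = Y omega} -> has_law P Y (centered_normal s).
Proof.
move=> Xs mY XY; apply: (@centered_normal_lim _ _ _ P (fun=> X) _ (fun=> s)) => //.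
  by apply: filterS XY => omega ->; exact: cvg_cst.
exact: cvg_cst.
Qed.

(** * Exact variances and covariances of the masses *)

Section CascadeCovariance.
Context {d} {T : measurableType d} {R : realType} (P : probability T R).
Context {b : nat} (hb : (2 <= b)%N) (xi : seq 'I_b -> T -> R).
Hypothesis xi_indep : mutually_independent P [set w | w != [::]] xi.
Hypothesis xi_law : forall w : seq 'I_b, w != [::] ->
  has_law P (xi w) (normal_prob 0 1).
Implicit Types (w u v : seq 'I_b) (omega : T).
Local Notation M := (cylinder_mass xi).
Local Notation B := (b%:R : R).

Let b_gt0 : 0 < B. Proof. by rewrite ltr0n ltnW. Qed.
Let bn0 : B != 0. Proof. by rewrite gt_eqF. Qed.
Let b1_gt0 : 0 < B - 1. Proof. by rewrite subr_gt0 ltr1n. Qed.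
Let b1n0 : B - 1 != 0. Proof. by rewrite gt_eqF. Qed.

(* Coefficient of [xi u] in the bracket defining the mass of [w]. *)
Definition coef w u : R :=
  if (size u <= size w)%N then (u == take (size u) w)%:R
  else (take (size w) u == w)%:R * B ^- (size u - size w).

Let sum_indicator (s : seq (seq 'I_b)) (Q : pred (seq 'I_b)) (f : seq 'I_b -> R) :
  \sum_(u <- s) (Q u)%:R * f u = \sum_(u <- s | Q u) f u.
Proof.
by rewrite [RHS]big_mkcond; apply: eq_bigr => u _; case: (Q u); rewrite ?mul1r ?mul0r.
Qed.

(** Up to length [size w] only prefixes of [w] have a nonzero coefficient, beyond it only extensions
    of [w]; the cutoff [size w + n] matches [tail_sum] at rank [n]. *)
Lemma sum_coef (f : seq 'I_b -> R) w n :
  \sum_(u <- words (size w + n)) coef w u * f u =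
  \sum_(1 <= k < n.+1) \sum_(v <- level k) B ^- k * f (w ++ v) +
  \sum_(1 <= k < (size w).+1) f (take k w).
Proof.
rewrite sum_words (@big_cat_nat _ _ _ (size w).+1)//=; last first.
  by rewrite ltnS leq_addr.
rewrite addrC; congr (_ + _).
  rewrite -[X in \sum_(X <= _ < _) _]add1n big_addn.
  rewrite (_ : ((size w + n).+1 - size w = n.+1)%N); last by lia.
  apply: eq_big_nat => k /andP[k0 _].
  rewrite -(sum_level_prefix (fun u => B ^- k * f u)) -[RHS]sum_indicator addnC.
  rewrite big_seq [RHS]big_seq; apply: eq_bigr => u; rewrite mem_level => /eqP uk.
  rewrite /coef uk -[X in (_ <= X)%N](addn0 (size w)) leq_add2l leqNgt k0/= addKn.
  by rewrite mulrA.
apply: eq_big_nat => k /andP[k0 kw]; rewrite ltnS in kw.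
rewrite -[RHS](sum_level_pred1 _ (size_takel kw)) -[RHS]sum_indicator.
rewrite big_seq [RHS]big_seq; apply: eq_bigr => u; rewrite mem_level => /eqP uk.
by rewrite /coef uk kw.
Qed.

Lemma partial_massE n w omega : partial_mass xi n w omega =
  B ^- size w * Num.sqrt (B - 1) *
  \sum_(u <- words (size w + n)) coef w u * xi u omega.
Proof.
rewrite (sum_coef (fun u => xi u omega)) /partial_mass /tail_sum.
congr (_ * (_ + _)); apply: eq_bigr => k _.
by rewrite (sum_tuple (fun v => B ^- k * xi (w ++ v) omega)).
Qed.

Lemma sum_geometric n : \sum_(1 <= k < n.+1) B ^- k = (1 - B ^- n) / (B - 1).
Proof.
elim: n => [|n IH]; first by rewrite big_geq// expr0 invr1 subrr mul0r.
rewrite big_nat_recr//= IH exprS; field.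
by rewrite bn0 b1n0 expf_neq0.
Qed.

(** Each common nonempty prefix contributes 1. At depth [k] below, no word extends both [w] and [w']
    unless they are equal, and then the [b ^ k] extensions contribute [b ^- (2 * k)] each. *)
Lemma sum_coef_coef w w' n : size w = size w' ->
  \sum_(u <- words (size w + n)) coef w u * coef w' u =
  (size (lcp w w'))%:R + (w == w')%:R * ((1 - B ^- n) / (B - 1)).
Proof.
move=> ww'; rewrite sum_coef addrC; congr (_ + _).
  rewrite -sum_take_eq// natr_sum; apply: eq_big_nat => k /andP[k0 kw].
  by rewrite ltnS in kw; rewrite /coef size_takel// -ww' kw.
rewrite -sum_geometric mulr_sumr; apply: eq_big_nat => k /andP[k0 _].
transitivity (\sum_(v <- @level b k) B ^- k * ((w == w')%:R * B ^- k)).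
  rewrite big_seq [RHS]big_seq; apply: eq_bigr => v; rewrite mem_level => /eqP vk.
  rewrite /coef size_cat -ww' vk addKn take_size_cat//.
  by have -> : (size w + k <= size w)%N = false by lia.
rewrite -(big_map (fun=> tt) xpredT (fun=> B ^- k * ((w == w')%:R * B ^- k))).
rewrite big_const_seq count_predT size_map size_level iter_addr_0 -[LHS]mulr_natl natrX.
by rewrite mulrA divff ?mul1r// expf_neq0.
Qed.

Let kappa (J : nat) : R := B ^- J * Num.sqrt (B - 1).

Let kappa2 J : kappa J ^+ 2 = B ^- (2 * J) * (B - 1).
Proof. by rewrite exprMn sqr_sqrtr ?(ltW b1_gt0)// exprVn -exprM mulnC. Qed.

(** Free coefficients serve two purposes: [(1, 0)] gives the law of one mass and [(1, 1)] that of a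
    sum, which is all that polarization uses. *)
Lemma mass_comb_law w w' (a a' : R) : size w = size w' ->
  has_law P (fun omega => a * M w omega + a' * M w' omega)
   (centered_normal (Num.sqrt (B ^- (2 * size w) *
     ((a ^+ 2 + a' ^+ 2) * (1 + (B - 1) * (size w)%:R) +
      a * a' * 2 * ((w == w')%:R + (B - 1) * (size (lcp w w'))%:R))))).
Proof.
move=> ww'; set J := size w.
(* The variance is recast as the limit of [S n]: [1 - 0] is the limit of [1 - B ^- n], and the
   factor [B - 1] in [kappa J ^+ 2] cancels the denominator of the geometric sum. *)
have -> : B ^- (2 * J) * ((a ^+ 2 + a' ^+ 2) * (1 + (B - 1) * J%:R) +
    a * a' * 2 * ((w == w')%:R + (B - 1) * (size (lcp w w'))%:R)) =
  kappa J ^+ 2 * ((a ^+ 2 + a' ^+ 2) * (J%:R + ((1 - 0) / (B - 1))) +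
    a * a' * 2 * ((size (lcp w w'))%:R + (w == w')%:R * ((1 - 0) / (B - 1)))).
  by rewrite kappa2; field; rewrite b1n0 expf_neq0.
pose S n : R := kappa J ^+ 2 * ((a ^+ 2 + a' ^+ 2) * (J%:R + ((1 - B ^- n) / (B - 1))) +
   a * a' * 2 * ((size (lcp w w'))%:R + (w == w')%:R * ((1 - B ^- n) / (B - 1)))).
pose c (u : seq (ordinal b)) := kappa J * (a * coef w u + a' * coef w' u).
have lcpid (v : seq 'I_b) : lcp v v = v.
  by elim: v => //= l v ->; rewrite eqxx.
have SE n : S n = \sum_(u <- words (J + n)) c u ^+ 2.
  rewrite /c; under eq_bigr do rewrite exprMn.
  rewrite -mulr_sumr; congr (_ * _).
  transitivity (\sum_(u <- words (J + n)) (a ^+ 2 * (coef w u * coef w u) +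
     a' ^+ 2 * (coef w' u * coef w' u) + a * a' * 2 * (coef w u * coef w' u))).
    rewrite !big_split/= -!mulr_sumr sum_coef_coef// lcpid eqxx.
    rewrite /J ww' sum_coef_coef// lcpid eqxx -ww' sum_coef_coef// !mul1r.
    by rewrite mulrDl.
  by apply: eq_bigr => u _; ring.
apply: (@centered_normal_lim _ _ _ P
  (fun n omega => a * partial_mass xi n w omega + a' * partial_mass xi n w' omega) _
  (fun n => Num.sqrt (S n))).
- move=> n; rewrite SE.
  rewrite (_ : (fun omega => _) = (fun omega => \sum_(u <- words (J + n)) c u * xi u omega)).
    apply: (indep_normal_sum xi_indep xi_law); first exact: words_uniq.
    by move=> u /=; rewrite mem_words -size_eq0 lt0n => /andP[].
  apply/funext => omega; rewrite !partial_massE -ww' -/J -/(kappa J) !mulr_sumr -big_split/=.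
  by apply: eq_bigr => u _; rewrite /c; ring.
- apply: measurable_funD; apply: measurable_funM => //; exact: (measurable_cylinder_mass xi_indep xi_law).
- apply: filterS (partial_mass_cvg_ae hb xi_indep xi_law) => omega H.
  apply: cvgD; (apply: cvgM; [exact: cvg_cst|exact: H]).
- apply: (cvg_comp S Num.sqrt); last exact: sqrt_continuous.
  have c0 : (1 - B ^- n) / (B - 1) @[n --> \oo] --> (1 - 0) / (B - 1).
    apply: cvgM; last exact: cvg_cst.
    apply: cvgB; first exact: cvg_cst.
    under eq_cvg do rewrite -exprVn.
    apply: cvg_expr; rewrite ger0_norm ?invr_ge0 ?ltW// invf_lt1// ltr1n//.
  apply: cvgM; first exact: cvg_cst.
  apply: cvgD; (apply: cvgM; first exact: cvg_cst).
    by apply: cvgD; [exact: cvg_cst|].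
  apply: cvgD; first exact: cvg_cst.
  by apply: cvgM; first exact: cvg_cst.
Qed.

Lemma mass_law w : has_law P (M w)
  (centered_normal (Num.sqrt (B ^- (2 * size w) * (1 + (B - 1) * (size w)%:R)))).
Proof.
have := @mass_comb_law w w 1 0 erefl.
rewrite expr1n expr0n/= addr0 mul1r mulr0 !mul0r addr0.
by congr has_law; apply/funext => omega; rewrite mul1r mul0r addr0.
Qed.

(** Stated for almost sure copies of the masses, because the increments of a primitive equal the
    masses only almost surely. *)
Lemma covariance_mass (w w' : seq 'I_b) (Y Y' : T -> R) : size w = size w' ->
  measurable_fun setT Y -> measurable_fun setT Y' ->
  {ae P, forall omega, M w omega = Y omega} ->
  {ae P, forall omega, M w' omega = Y' omega} ->
  covariance P Y Y' =
  (B ^- (2 * size w) * ((w == w')%:R + (B - 1) * (size (lcp w w'))%:R))%:E.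
Proof.
move=> ww' mY mY' MY MY'.
have H : has_law P (fun omega => Y omega + Y' omega)
   (centered_normal (Num.sqrt (B ^- (2 * size w) *
     (2 * (1 + (B - 1) * (size w)%:R) +
      2 * ((w == w')%:R + (B - 1) * (size (lcp w w'))%:R))))).
  have := @mass_comb_law w w' 1 1 ww'; rewrite expr1n !mul1r => /centered_normal_ae; apply.
    exact: measurable_funD.
  by apply: filterS2 MY MY' => omega -> ->; rewrite !mul1r.
have q0 : 0 <= B ^- (2 * size w) by rewrite invr_ge0 exprn_ge0// ltW.
have v0 : 0 <= 1 + (B - 1) * (size w)%:R by rewrite addr_ge0// mulr_ge0// ltW.
rewrite (covariance_centered_normal (centered_normal_ae (mass_law w) mY MY)
  (centered_normal_ae (mass_law w') mY' MY') H); congr EFin.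
rewrite !sqr_sqrtr -?ww' ?mulr_ge0//; last first.
  by rewrite addr_ge0// mulr_ge0// addr_ge0// mulr_ge0// ltW.
by field; rewrite expf_neq0.
Qed.

End CascadeCovariance.

(** * The continuous process *)

Section CascadeProcess.
Context {d} {T : measurableType d} {R : realType} (P : probability T R).
Context {b : nat} (hb : (2 <= b)%N) (xi : seq 'I_b -> T -> R).
Hypothesis xi_indep : mutually_independent P [set w | w != [::]] xi.
Hypothesis xi_law : forall w : seq 'I_b, w != [::] ->
  has_law P (xi w) (normal_prob 0 1).
Implicit Types (w u v : seq 'I_b) (omega : T).
Local Notation M := (cylinder_mass xi).
Local Notation B := (b%:R : R).

Let b_gt0 : 0 < B. Proof. by rewrite ltr0n ltnW. Qed.
Let bn0 : B != 0. Proof. by rewrite gt_eqF. Qed.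
Let b1_gt0 : 0 < B - 1. Proof. by rewrite subr_gt0 ltr1n. Qed.

Let mM w : measurable_fun setT (M w).
Proof. exact: (measurable_cylinder_mass xi_indep xi_law). Qed.

(** Number of words times the variance of one mass. For [j >= 1] this is at most [2 * j * 2 ^- j];
    absorbing [j] into [4 * (5 / 4) ^+ j] gives the ratio 5/8 and the constant 8. *)
Lemma level_variance_bound (j : nat) :
  (b ^ j)%:R * (B ^- (2 * j) * (1 + (B - 1) * j%:R)) <= 8 * (5 / 8) ^+ j.
Proof.
have -> : (b ^ j)%:R * (B ^- (2 * j) * (1 + (B - 1) * j%:R)) =
    B ^- j * (1 + (B - 1) * j%:R).
  by rewrite natrX mul2n -addnn exprD; field; rewrite expf_neq0.
case: j => [|j]; first by rewrite !expr0 mulr0; lra.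
have h1 : B ^- j.+1 * (1 + (B - 1) * j.+1%:R) <= B ^- j.+1 * (B * j.+1%:R).
  rewrite ler_wpM2l ?invr_ge0 ?exprn_ge0 ?(ltW b_gt0)// mulrBl mul1r.
  have : 1 <= j.+1%:R :> R by rewrite ler1n.
  lra.
apply: (le_trans h1).
have -> : B ^- j.+1 * (B * j.+1%:R) = B ^- j * j.+1%:R.
  by rewrite exprS; field; rewrite bn0 expf_neq0.
have h2 : B ^- j * j.+1%:R <= 2 ^- j * j.+1%:R.
  rewrite ler_wpM2r// lef_pV2 ?posrE ?exprn_gt0//.
  by rewrite lerXn2r ?nnegrE ?(ltW b_gt0)// ler_nat.
apply: (le_trans h2).
(* Each induction step adds 1 on the left and a power of 5/4, hence at least 1, on the right. *)
have h3 : j.+1%:R <= 4 * (5 / 4) ^+ j.+1 :> R.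
  elim: j {h1 h2} => [|j IH]; first by rewrite expr1; lra.
  rewrite -natr1 exprS.
  have : 1 <= (5 / 4) ^+ j.+1 :> R by rewrite exprn_ege1//; lra.
  move: IH; set x := (5 / 4) ^+ j.+1; lra.
have -> : (5 / 8) ^+ j.+1 = 2 ^- j * ((5 / 4) ^+ j.+1 / 2) :> R.
  rewrite (_ : 5 / 8 = 2^-1 * (5 / 4)); last by field.
  by rewrite exprMn exprVn exprS; field; rewrite expf_neq0.
rewrite mulrCA ler_wpM2l ?invr_ge0 ?exprn_ge0//.
by move: h3; set x := (5 / 4) ^+ j.+1; lra.
Qed.

(** The sum of squares over a level bounds each of its terms, so one constant serves all words; 3/4
    lies between 5/8 and 1, and its square root appears because squares are bounded. *)
Lemma mass_bound_ae : {ae P, forall omega, exists C, forall w,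
  `|M w omega| <= C * Num.sqrt (3 / 4) ^+ size w}.
Proof.
pose Z j omega := \sum_(w <- @level b j) M w omega ^+ 2.
have mZ j : measurable_fun setT (Z j).
  by apply: measurable_sum => w; exact: measurable_funX.
have Z0 j omega : 0 <= Z j omega by apply: sumr_ge0 => w _; exact: sqr_ge0.
have Z_int j : (\int[P]_omega (Z j omega)%:E <= (8 * (5 / 8) ^+ j)%:E)%E.
  under eq_integral do rewrite -sumEFin.
  rewrite ge0_integral_sum//; last 2 first.
  - by move=> w; apply/measurable_EFinP; exact: measurable_funX.
  - by move=> w omega _; rewrite lee_fin sqr_ge0.
  rewrite (eq_big_seq (fun=> (B ^- (2 * j) * (1 + (B - 1) * j%:R))%:E)); last first.
    move=> w; rewrite mem_level => /eqP wj.
    rewrite (centered_normal_sqr (mass_law hb xi_indep xi_law w)) wj sqr_sqrtr//.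
    by rewrite mulr_ge0 ?invr_ge0 ?exprn_ge0 ?addr_ge0 ?mulr_ge0 ?(ltW b_gt0) ?(ltW b1_gt0).
  rewrite sumEFin lee_fin -(big_map (fun=> tt) xpredT (fun=> B ^- (2 * j) * (1 + (B - 1) * j%:R))).
  rewrite big_const_seq count_predT size_map size_level iter_addr_0 -[leLHS]mulr_natl.
  exact: level_variance_bound.
have h1 : 0 <= 5 / 8 :> R by lra.
have h2 : 5 / 8 < 3 / 4 :> R by lra.
have := ae_geometric_bound h1 h2 mZ Z0 Z_int.
apply: filterS => omega [C HC].
have C0 : 0 <= C.
  by have := HC 0%N; rewrite expr0 mulr1; apply: le_trans.
exists (Num.sqrt C) => w.
apply: norm_le_sqrt_geometric => //; apply: le_trans (HC (size w)).
rewrite /Z (bigD1_seq w) ?level_uniq ?mem_level//= lerDl.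
by apply: sumr_ge0 => u _; exact: sqr_ge0.
Qed.

Let sqrt34_lt1 : Num.sqrt (3 / 4) < 1 :> R.
Proof. by rewrite -[ltRHS]sqrtr1 ltr_sqrt//; lra. Qed.

(** Continuity and vanishing at 0 are required for every [omega], so the masses are set to 0 on a
    measurable null set [N] containing all bad points. Decay and additivity then hold everywhere,
    and [primitive] is applied path by path. *)
Lemma is_primitive_exists : exists X : R -> T -> R, is_primitive P M X.
Proof.
have [N [mN N0 NP]] : P.-negligible (~` [set omega |
    (exists C, forall w, `|M w omega| <= C * Num.sqrt (3 / 4) ^+ size w) /\
    (forall w, M w omega = \sum_(l < b) M (rcons w l) omega)]).
  apply: filterS2 mass_bound_ae (cylinder_mass_additive_ae hb xi_indep xi_law).
  by move=> omega h1 h2; split.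
have good omega : omega \notin N ->
    (exists C, forall w, `|M w omega| <= C * Num.sqrt (3 / 4) ^+ size w) /\
    (forall w, M w omega = \sum_(l < b) M (rcons w l) omega).
  move=> /negP oN; apply: contrapT => h; apply: oN; rewrite inE.
  exact: NP.
pose M' w omega := if omega \in N then 0 else M w omega.
have mM' w : measurable_fun setT (M' w).
  apply: measurable_fun_ifT => //.
  rewrite (_ : (fun omega => omega \in N) = (fun omega => (\1_N omega : R) == 1)); last first.
    by apply/funext => omega; rewrite indicE; case: (omega \in N); rewrite ?eqxx// eq_sym oner_eq0.
  by apply: measurable_fun_eqr => //; exact: measurable_indic.
have M'_bound omega : exists C, forall w, `|M' w omega| <= C * Num.sqrt (3 / 4) ^+ size w.
  rewrite /M'; case: (boolP (omega \in N)) => [_|/good[]//].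
  by exists 0 => w; rewrite normr0 mul0r.
have M'_add omega w : M' w omega = \sum_(l < b) M' (rcons w l) omega.
  rewrite /M'; case: (boolP (omega \in N)) => [_|/good[]//].
  by rewrite big1.
exists (fun t omega => primitive hb (M' ^~ omega) t); split.
- move=> t _.
  apply: (measurable_fun_cvg (h := fun j omega =>
      lattice_sum hb (M' ^~ omega) j (@lattice_index R b j t))).
    by move=> j; apply: measurable_sum => i; exact: mM'.
  move=> omega _; have [C HC] := M'_bound omega.
  exact: (primitive_cvg (sqrtr_ge0 _) sqrt34_lt1 HC).
- move=> omega; have [C HC] := M'_bound omega.
  by apply: continuous_subspaceT; exact: (primitive_continuous (sqrtr_ge0 _) sqrt34_lt1 HC).
- by move=> omega; exact: primitive0.
- exists N; split => // omega /= oN; apply: contrapT => nN; apply: oN => w.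
  rewrite (Delta_primitive hb (M'_add omega)).
  by rewrite /M'; case: (boolP (omega \in N)) => //; rewrite inE.
Qed.

(** The exceptional set comes only from the identities on increments, so it is common to all [t];
    off it, continuity recovers both paths from the same masses. *)
Lemma is_primitive_unique (X Y : R -> T -> R) :
  is_primitive P M X -> is_primitive P M Y ->
  {ae P, forall omega t, t \in `[0, 1] -> X t omega = Y t omega}.
Proof.
move=> [_ cX X0 XM] [_ cY Y0 YM]; apply: filterS2 XM YM => omega HX HY t t01.
have h1 := lattice_sum_Delta hb (cX omega) t01.
have h2 := lattice_sum_Delta hb (cY omega) t01.
rewrite X0 subr0 in h1; rewrite Y0 subr0 in h2.
rewrite -(cvg_lim _ h1)// -(cvg_lim _ h2)//.
by congr (limn _); apply/funext => j; apply: eq_bigr => i _; rewrite HX HY.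
Qed.

Lemma primitive_span_law (X : R -> T -> R) (Y : T -> R) : is_primitive P M X ->
  in_span `[0, 1]%classic X Y -> exists s, has_law P Y (centered_normal s).
Proof.
move=> [mX cX X0 XM] [s [s01 ->]].
pose Y_ j omega := \sum_(p <- s) p.1 *
  \sum_(0 <= i < @lattice_index R b j p.2) M (digits hb j i) omega.
have Y_law j : exists sg, has_law P (Y_ j) (centered_normal sg).
  apply: (mass_span_law hb xi_indep xi_law); apply: in_span_sum => p _.
  apply: in_span_scale; apply: in_span_sum => i _; exact: in_span_gen.
have [sg Y_sg] := choice Y_law.
apply: (centered_normal_closed Y_sg).
  (* [X t] is known to be measurable only for [t] in [[0, 1]]; the value 0 elsewhere allows a lemma
     on sums that asks for measurability at every index. The same device serves for the limit
     below. *)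
  have -> : (fun omega => \sum_(p <- s) p.1 * X p.2 omega) =
      (fun omega => \sum_(p <- s) p.1 * (if p.2 \in `[0, 1] then X p.2 omega else 0)).
    apply/funext => omega; rewrite big_seq [RHS]big_seq; apply: eq_bigr => p ps.
    by have -> : p.2 \in `[0, 1] by exact: s01.
  apply: measurable_sum => p; apply: measurable_funM => //.
  by case: (boolP (p.2 \in `[0, 1])) => // p01; exact: mX.
apply: filterS XM => omega HX.
rewrite (_ : (fun j => Y_ j omega) = (fun j => \sum_(p <- s) p.1 *
    (if p.2 \in `[0, 1] then
       \sum_(0 <= i < @lattice_index R b j p.2) Delta (X ^~ omega) (digits hb j i) else 0))); last first.
  apply/funext => j; rewrite /Y_ big_seq [RHS]big_seq; apply: eq_bigr => p ps.
  have -> : p.2 \in `[0, 1] by exact: s01.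
  by congr (_ * _); apply: eq_bigr => i _; rewrite HX.
rewrite (_ : \sum_(p <- s) p.1 * X p.2 omega =
    \sum_(p <- s) p.1 * (if p.2 \in `[0, 1] then X p.2 omega else 0)); last first.
  rewrite big_seq [RHS]big_seq; apply: eq_bigr => p ps.
  by have -> : p.2 \in `[0, 1] by exact: s01.
apply: cvg_sumr => p; apply: cvgM; first exact: cvg_cst.
case: (boolP (p.2 \in `[0, 1])) => [p01|_]; last exact: cvg_cst.
have := lattice_sum_Delta hb (cX omega) p01.
by rewrite X0 subr0.
Qed.

End CascadeProcess.

Theorem mainTheorem3 (R : realType) (d : measure_display)
    (T : measurableType d) (P : probability T R)
    (b : nat) (hb : (2 <= b)%N)
    (xi : seq 'I_b -> T -> R)
    (xi_indep : mutually_independent P [set w | w != [::]] xi)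
    (xi_law : forall w : seq 'I_b, w != [::] ->
      has_law P (xi w) (normal_prob 0 1)) :
  let M := cylinder_mass xi in
  [/\ {ae P, forall omega, forall w : seq 'I_b, cvgn (tail_sum xi w omega)},
      gaussian_family P setT M,
      {ae P, forall omega, forall w : seq 'I_b,
        M w omega = \sum_(l < b) M (rcons w l) omega} &
      [/\ exists X : R -> T -> R, is_primitive P M X,
          forall X Y : R -> T -> R,
            is_primitive P M X -> is_primitive P M Y ->
            {ae P, forall omega, forall t : R, t \in `[0, 1] ->
              X t omega = Y t omega} &
          forall X : R -> T -> R, is_primitive P M X ->
            centered_gaussian_process P X /\
            forall (j : nat), (1 <= j)%N -> forall w w' : j.-tuple 'I_b,
              covariance P (fun omega => Delta (fun t => X t omega) w)
                           (fun omega => Delta (fun t => X t omega) w') =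
              (if w == w'
               then b%:R ^- (2 * j) * (1 + (b%:R - 1) * (size w)%:R)
               else b%:R ^- (2 * j) * (b%:R - 1) * (size (lcp w w'))%:R)%:E]].
Proof.
move=> M; split.
- exact: (tail_sum_cvg_ae hb xi_indep xi_law).
- move=> n i a _.
  have [|s] := mass_span_law hb xi_indep xi_law
    (Y := fun omega => \sum_(k < n) a k * M (i k) omega).
    apply: in_span_sum => k _; apply: in_span_scale; exact: in_span_gen.
  exact: gaussian_rv_centered_normal.
- exact: (cylinder_mass_additive_ae hb xi_indep xi_law).
split.
- exact: (is_primitive_exists hb xi_indep xi_law).
- move=> X Y; exact: (is_primitive_unique hb).
move=> X XP; split.
  split=> [n i a i01|t t01].
    have [|s] := primitive_span_law hb xi_indep xi_law XP
      (Y := fun omega => \sum_(k < n) a k * X (i k) omega).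
      by apply: in_span_sum => k _; apply: in_span_scale; exact: in_span_gen.
    exact: gaussian_rv_centered_normal.
  have [|s] := primitive_span_law hb xi_indep xi_law XP (Y := X t).
    exact: in_span_gen.
  exact: centered_normal_expectation.
move=> j _ w w'; have [mX _ _ XM] := XP.
have mD (v : seq 'I_b) : measurable_fun setT (fun omega => Delta (fun t => X t omega) v).
  by apply: measurable_funB; apply: mX; [exact: word_right_itv|exact: word_left_itv].
have DM (v : seq 'I_b) : {ae P, forall omega, M v omega = Delta (fun t => X t omega) v}.
  by apply: filterS XM => omega ->.
rewrite (covariance_mass hb xi_indep xi_law _ (mD w) (mD w') (DM w) (DM w')); last first.
  by rewrite !size_tuple.
(* The indicator of [w == w'] vanishes off the diagonal; on it, it is the 1 of the variance, and the
   longest common prefix is the whole word. *)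
rewrite val_eqE size_tuple; case: eqVneq => [->|ww']; last by rewrite add0r mulrA.
have lcpid (v : seq 'I_b) : lcp v v = v.
  by elim: v => //= l v ->; rewrite eqxx.
by rewrite lcpid size_tuple.
Qed.
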